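(* Let $0\le b_1\le b_2<\infty$ with $b_2>0$, and let $-\infty<\alpha_1\le\alpha_2<+\infty$. Suppose $\mathrm{Ad}_{[\alpha_1,\alpha_2]}\neq\emptyset$. Then: (i) the functional $\mathcal{J}_{[\alpha_1,\alpha_2]}$ achieves its minimum over $\mathrm{Ad}_{[\alpha_1,\alpha_2]}$, i.e., there exists $B_{\min}\in \mathrm{Ad}_{[\alpha_1,\alpha_2]}$ such that $\mathcal{J}_{[\alpha_1,\alpha_2]}(B_{\min})\le\mathcal{J}_{[\alpha_1,\alpha_2]}(B)$ for all $B\in\mathrm{Ad}_{[\alpha_1,\alpha_2]}$; (ii) the minimum $\mathcal{J}_{[\alpha_1,\alpha_2]}(B_{\min})$ is positive.
   Context: $\mathrm{Ad}:=\{B\in L^\infty_{\mathbb{R}}(0,1): b_1\le B(x)\le b_2 \text{ for a.a. } x\in(0,1)\}$. For $B\in L^\infty(0,1)$, a number $\kappa\in\mathbb{C}$, $\kappa\ne0$, is called a quasi-eigenvalue of $B$ if there is a nonzero solution $y\in W^{2,\infty}_{\mathbb{C}}[0,1]$ of $y''(x)+\kappa^2B(x)y(x)=0$ for a.a. $x\in(0,1)$ with $y'(0)=0$ and $y(1)-\mathrm{i}\,y'(1)/\kappa=0$. $K(B)$ denotes the set of all quasi-eigenvalues of $B$. $\mathrm{Ad}_{[\alpha_1,\alpha_2]}:=\{B\in\mathrm{Ad}: \operatorname{Re}\kappa\in[\alpha_1,\alpha_2]\text{ for a certain }\kappa\in K(B)\}$, and for $B\in \mathrm{Ad}_{[\alpha_1,\alpha_2]}$,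 $\mathcal{J}_{[\alpha_1,\alpha_2]}(B):=\inf\{\operatorname{Im}\kappa:\ \operatorname{Re}\kappa\in[\alpha_1,\alpha_2]\text{ and }\kappa\in K(B)\}$. *)

(* Defs.v *)
From HB Require Import structures.
From mathcomp Require Import all_boot all_order all_algebra.
From mathcomp Require Import all_classical all_reals all_analysis.
From mathcomp Require Import complex.

Set Implicit Arguments.
Unset Strict Implicit.
Unset Printing Implicit Defensive.

Import Order.TTheory GRing.Theory Num.Theory.
Import numFieldNormedType.Exports.

Local Open Scope classical_set_scope.
Local Open Scope ring_scope.

(* Elements of L^oo(0, 1) are represented by functions on R, whose values
   outside ]0, 1[ are irrelevant; equality in L^oo(0, 1) is equality a.e. *)
Definition Linfty (R : realType) (f : R -> R) : Prop :=
  measurable_fun (`]0, 1[ : set R) f /\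
  exists M : R, {ae lebesgue_measure, forall x : R,
    x \in `]0, 1[ -> `|f x| <= M}.

(* C^1 functions with compact support in ]0, 1[; testing against C^oo_c instead
   gives the same weak derivatives. *)
Definition test_fun (R : realType) (phi : R -> R) : Prop :=
  [/\ forall x : R, derivable (phi : R -> R) x 1,
      continuous (derive1 phi) &
      exists a b : R, [/\ 0 < a, b < 1 &
        forall x : R, x \notin `[a, b] -> phi x = 0]].

Definition weak_deriv (R : realType) (f g : R -> R) : Prop :=
  forall phi : R -> R, test_fun phi ->
    \int[lebesgue_measure]_(x in (`]0, 1[ : set R)) (f x * derive1 phi x) =
    - \int[lebesgue_measure]_(x in (`]0, 1[ : set R)) (g x * phi x).

(* f in W^{1,oo}[0, 1] with weak derivative g. Boundary values are those of the
   continuous representative, so f is required to be that representative. *)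
Definition W1infty (R : realType) (f g : R -> R) : Prop :=
  [/\ {within (`[0, 1] : set R), continuous f},
      Linfty f, Linfty g & weak_deriv f g].

(* y in W^{2,oo}[0, 1] with y' = y1 and y'' = y2. *)
Definition W2infty (R : realType) (y y1 y2 : R -> R) : Prop :=
  W1infty y y1 /\ W1infty y1 y2.

Definition W2inftyC (R : realType) (y y1 y2 : R -> R[i]) : Prop :=
  W2infty (fun x => complex.Re (y x)) (fun x => complex.Re (y1 x))
          (fun x => complex.Re (y2 x)) /\
  W2infty (fun x => complex.Im (y x)) (fun x => complex.Im (y1 x))
          (fun x => complex.Im (y2 x)).

Definition quasi_eigenvalues (R : realType) (B : R -> R) : set R[i] :=
  [set kappa : R[i] | kappa != 0 /\
    exists y y1 y2 : R -> R[i],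
      [/\ W2inftyC y y1 y2,
          exists2 x : R, x \in `[0, 1] & y x != 0,
          {ae lebesgue_measure, forall x : R, x \in `]0, 1[ ->
            y2 x + kappa ^+ 2 * (B x)%:C%C * y x = 0},
          y1 0 = 0 &
          y 1 - 'i%C * y1 1 / kappa = 0]].

Definition Ad (R : realType) (b1 b2 : R) : set (R -> R) :=
  [set B : R -> R | Linfty B /\
    {ae lebesgue_measure, forall x : R, x \in `]0, 1[ -> b1 <= B x <= b2}].

Definition Ad_strip (R : realType) (b1 b2 alpha1 alpha2 : R) : set (R -> R) :=
  [set B : R -> R | Ad b1 b2 B /\
    exists2 kappa : R[i], quasi_eigenvalues B kappa &
      alpha1 <= complex.Re kappa <= alpha2].

(* The infimum is taken in the extended reals, so that it is meaningful without
   knowing beforehand that the set is bounded below. *)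
Definition J_strip (R : realType) (alpha1 alpha2 : R) (B : R -> R) : \bar R :=
  ereal_inf [set (complex.Im kappa)%:E | kappa in
    [set kappa : R[i] | alpha1 <= complex.Re kappa <= alpha2 /\
                        quasi_eigenvalues B kappa]].

(* Main.v *)
Require Import Defs.
From HB Require Import structures.
From mathcomp Require Import all_boot all_order all_algebra.
From mathcomp Require Import all_classical all_reals all_analysis.
From mathcomp Require Import complex measurable_realfun.
From mathcomp Require Import ring lra.

Set Implicit Arguments.
Unset Strict Implicit.
Unset Printing Implicit Defensive.

Import Order.TTheory GRing.Theory Num.Theory.
Import numFieldNormedType.Exports.

Local Open Scope classical_set_scope.
Local Open Scope ring_scope.

(** Write kappa = a + i b, y = u + i v and y' = p + i q, and let beta be a primitive
of B.  Multiplying the equation by the conjugate of y and integrating gives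
two real energy identities which force b to be positive: for a <> 0 the
imaginary part of the identity is a |y(1)|^2 = 2 a b \int B |y|^2, and for a = 0 its
real part is b |y(1)|^2 = \int |y'|^2 + b^2 \int B |y|^2.  If b were nonpositive, y(1)
would vanish, hence y'(1) as well by the boundary condition, and y would be zero
by uniqueness for the Cauchy problem at 1.  Therefore the imaginary parts of all
quasi-eigenvalues in the strip form a set of positive numbers, and it suffices
to show that the infimum of this set belongs to it.

Along a minimizing sequence the numbers kappa_n are bounded, the functions beta_n
have slopes in [b1, b2], and y_n, scaled to have maximum modulus 1, is uniformly
Lipschitz together with y_n'.  Only primitives of the B_n occur, so weak-star
compactness is replaced by pointwise convergence: everything that has to survive
in the limit is expressed by non-strict inequalities between values of the
functions.  The differential equation, for instance, becomes
    | y'(z) - y'(x) + kappa^2 y(x) (beta(z) - beta(x)) | <= C (z - x)^2,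
where C depends only on b2 and on a bound for kappa.  The resulting notion is
the record [mode].  All its conditions pass to pointwise limits, and pointwise
limits of bounded sequences along a nonprincipal ultrafilter always exist, so no
subsequence is extracted ([mode_limit]).

Inequalities with a quadratic error are as good as derivatives, because a
function whose increments are at least - C (z - x)^2 is nondecreasing: cut [x, z]
into n pieces and let n grow ([quad_nondecreasing]).  This gives the energy
argument without integrals ([mode_Im_gt0]), Gronwall's lemma
([backward_gronwall]), and integration by parts.  The case kappa = 0, which
must be excluded in the limit, is ruled out by |y(1)|^2 <= C |kappa|^2, a trace of
the division by kappa in the boundary condition: at kappa = 0 it yields
y(1) = 0.

It remains to relate modes to quasi-eigenvalues.  A function beta with slopes in
[b1, b2] is a primitive of some B with values in [b1, b2], by the Radon-Nikodym
theorem for its Lebesgue-Stieltjes measure ([bounded_slope_density]).  Weak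
derivatives are handled by the lemma of du Bois-Reymond ([weak_deriv_intg]) in
one direction and integration by parts ([intg_weak_deriv]) in the other; the
record [wave] is the integral form of the problem which lies in between. *)

(** * Functions that are monotone up to a quadratic error *)

Section almost_monotone.
Variable R : realType.
Implicit Types (F E : R -> R) (C K M x z : R).

Lemma normM_le x z C K : `|x| <= C -> `|z| <= K -> `|x * z| <= C * K.
Proof. by move=> xC zK; rewrite normrM ler_pM. Qed.

(** Cutting [x, z] into n equal pieces makes the total error C (z - x)^2 / n. *)
Lemma quad_nondecreasing F C :
    (forall x z, 0 <= x -> x <= z -> z <= 1 ->
      - C * (z - x) ^+ 2 <= F z - F x) ->
  forall x z, 0 <= x -> x <= z -> z <= 1 -> F x <= F z.
Proof.
move=> FC x z x0 xz z1.
have step n : - C * (z - x) ^+ 2 / n.+1%:R <= F z - F x.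
  pose h := (z - x) / n.+1%:R.
  have h0 : 0 <= h by rewrite divr_ge0// subr_ge0.
  have hn : h * n.+1%:R = z - x by rewrite divfK.
  have ind k : (k <= n.+1)%N -> - C * h ^+ 2 * k%:R <= F (x + h * k%:R) - F x.
    elim: k => [|k IH] kn; first by rewrite !mulr0 addr0 subrr.
    have := IH (ltnW kn).
    have kz : x + h * k.+1%:R <= z.
      rewrite -lerBrDl -hn ler_wpM2l// ler_nat//.
    have := FC (x + h * k%:R) (x + h * k.+1%:R) _ _ _.
    have -> : x + h * k.+1%:R - (x + h * k%:R) = h by rewrite -natr1; ring.
    rewrite -[in X in _ -> X]natr1 => /(_ _ _ _)/wrap[||| H1 H2].
    - by rewrite addr_ge0// mulr_ge0.
    - by rewrite lerD2l ler_wpM2l// ler_nat.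
    - exact: le_trans z1.
    - move: H1 H2; rewrite -natr1; lra.
  have := ind n.+1 (leqnn _); rewrite hn subrKC; apply: le_trans.
  by rewrite -hn le_eqVlt; apply/orP; left; apply/eqP; field.
rewrite leNgt; apply/negP => zx.
pose d := F x - F z; have d0 : 0 < d by rewrite subr_gt0.
pose n := Num.bound `|C * (z - x) ^+ 2 / d|.
have := step n; rewrite ler_pdivrMr// => H.
have : C * (z - x) ^+ 2 / d < n%:R.
  exact: le_lt_trans (ler_norm _) (archi_boundP (normr_ge0 _)).
rewrite ltr_pdivrMr// => H2.
have : (F z - F x) * n.+1%:R = - (n%:R * d) - d by rewrite /d -natr1; ring.
by move=> E; move: H H2 d0; rewrite E; lra.
Qed.

Lemma quad_constant F C :
    (forall x z, 0 <= x -> x <= z -> z <= 1 ->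
      `|F z - F x| <= C * (z - x) ^+ 2) ->
  forall x, 0 <= x -> x <= 1 -> F x = F 0.
Proof.
move=> FC x x0 x1; apply/eqP; rewrite eq_le; apply/andP; split.
- rewrite -lerN2; apply: (@quad_nondecreasing (fun x => - F x) C) => // s t.
  by move=> s0 st t1; have := FC s t s0 st t1; rewrite ler_norml; lra.
- apply: (@quad_nondecreasing F C) => // s t.
  by move=> s0 st t1; have := FC s t s0 st t1; rewrite ler_norml; lra.
Qed.

(** The function exp (K x) E x is nondecreasing up to a quadratic error,
although E need not be differentiable. *)
Lemma backward_gronwall E K C M : 0 <= K ->
    (forall x, 0 <= x -> x <= 1 -> 0 <= E x <= M) ->
    (forall x z, 0 <= x -> x <= z -> z <= 1 ->
      - K * E x * (z - x) - C * (z - x) ^+ 2 <= E z - E x) ->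
    E 1 <= 0 ->
  forall x, 0 <= x -> x <= 1 -> E x <= 0.
Proof.
move=> K0 EM EK E1 x x0 x1.
pose F x := expR (K * x) * E x.
have : F x <= F 1.
  apply: (@quad_nondecreasing F (expR K * (K ^+ 2 * M + `|C|))) => // s t s0 st t1.
  have /andP[Es0 EsM] := EM s s0 (le_trans st t1).
  have M0 : 0 <= M by exact: le_trans Es0 EsM.
  have := EK s t s0 st t1.
  set d := t - s; have d0 : 0 <= d by rewrite subr_ge0.
  set G := expR (K * t); set G' := expR (K * s) => h.
  have G0 : 0 < G by exact: expR_gt0.
  have G'0 : 0 < G' by exact: expR_gt0.
  have Kd0 : 0 <= K * d by exact: mulr_ge0.
  have h1 : G' * (1 + K * d) <= G.
    rewrite /G (_ : K * t = K * s + K * d); last by rewrite /d; ring.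
    by rewrite expRD ler_pM2l// expR_ge1Dx.
  have h2 : G * (1 - K * d) <= G'.
    rewrite /G' (_ : K * s = K * t + - (K * d)); last by rewrite /d; ring.
    by rewrite expRD ler_pM2l// expR_ge1Dx.
  have h3 : G <= expR K by rewrite ler_expR ler_piMr.
  have h4 : - K * E s * d - `|C| * d ^+ 2 <= E t - E s.
    apply: le_trans h; rewrite lerD2l lerN2 ler_wpM2r ?sqr_ge0 ?ler_norm//.
  rewrite /F -/G -/G'.
  have a1 : G * (- K * E s * d - `|C| * d ^+ 2) <= G * (E t - E s).
    by rewrite ler_pM2l.
  have a2 : G' * (K * d) * E s <= (G - G') * E s by rewrite ler_wpM2r//; lra.
  have a3 : (G - G') * (K * d) * E s <= G * (K * d) * (K * d) * M.
    rewrite ler_pM//; first by rewrite mulr_ge0// subr_ge0; nra.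
    by rewrite ler_wpM2r//; lra.
  have a4 : G * (K ^+ 2 * M + `|C|) * d ^+ 2 <= expR K * (K ^+ 2 * M + `|C|) * d ^+ 2.
    rewrite ler_wpM2r ?sqr_ge0// ler_wpM2r// addr_ge0//.
    by rewrite mulr_ge0// sqr_ge0.
  nra.
rewrite /F mulr1 => H.
have : expR (K * x) * E x <= 0.
  by apply: le_trans H _; rewrite mulr_ge0_le0// expR_ge0.
by rewrite pmulr_rle0// expR_gt0.
Qed.

End almost_monotone.

(** * Modes: quasi-eigenvalues seen through pointwise inequalities *)

(** What remains of a quasi-eigenvalue a + i b with eigenfunction u + i v, of
derivative p + i q, once the coefficient is replaced by its primitive beta. All
conditions are preserved by pointwise limits with C, b1 and b2 fixed (for
[mode_sup], thanks to the Lipschitz bounds). The differential equations are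
Taylor estimates [mode_du] to [mode_dq], in which a^2 - b^2 and 2 a b are the
real and imaginary parts of kappa^2. The conditions [mode_p1] and [mode_q1] say
that y'(1) = - i kappa y(1); being multiplied by kappa they are void at kappa =
0, which [mode_small] compensates for. *)
Record mode (R : realType) (C b1 b2 a b : R) (beta u v p q : R -> R) : Prop := Mode {
  mode_beta0 : beta 0 = 0;
  mode_beta : forall x z, 0 <= x -> x <= z -> z <= 1 ->
    b1 * (z - x) <= beta z - beta x <= b2 * (z - x);
  mode_sup : exists x, [/\ 0 <= x, x <= 1 & u x ^+ 2 + v x ^+ 2 = 1];
  mode_le1 : forall x, 0 <= x -> x <= 1 -> u x ^+ 2 + v x ^+ 2 <= 1;
  mode_p0 : p 0 = 0;
  mode_q0 : q 0 = 0;
  mode_p1 : p 1 = b * u 1 + a * v 1;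
  mode_q1 : q 1 = b * v 1 - a * u 1;
  mode_small : u 1 ^+ 2 + v 1 ^+ 2 <= C * (a ^+ 2 + b ^+ 2);
  mode_pC : forall x, 0 <= x -> x <= 1 -> `|p x| <= C;
  mode_qC : forall x, 0 <= x -> x <= 1 -> `|q x| <= C;
  mode_lip : forall x z, 0 <= x -> x <= z -> z <= 1 ->
    [/\ `|u z - u x| <= C * (z - x), `|v z - v x| <= C * (z - x),
        `|p z - p x| <= C * (z - x) & `|q z - q x| <= C * (z - x)];
  mode_du : forall x z, 0 <= x -> x <= z -> z <= 1 ->
    `|u z - u x - p x * (z - x)| <= C * (z - x) ^+ 2;
  mode_dv : forall x z, 0 <= x -> x <= z -> z <= 1 ->
    `|v z - v x - q x * (z - x)| <= C * (z - x) ^+ 2;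
  mode_dp : forall x z, 0 <= x -> x <= z -> z <= 1 ->
    `|p z - p x + ((a ^+ 2 - b ^+ 2) * u x - 2 * a * b * v x) * (beta z - beta x)|
      <= C * (z - x) ^+ 2;
  mode_dq : forall x z, 0 <= x -> x <= z -> z <= 1 ->
    `|q z - q x + ((a ^+ 2 - b ^+ 2) * v x + 2 * a * b * u x) * (beta z - beta x)|
      <= C * (z - x) ^+ 2
}.

Section mode_theory.
Variables (R : realType) (C b1 b2 a b : R) (beta u v p q : R -> R).
Hypotheses (b1_ge0 : 0 <= b1) (b1_le_b2 : b1 <= b2).
Hypothesis M : mode C b1 b2 a b beta u v p q.

Lemma mode_C_ge0 : 0 <= C.
Proof. by have := mode_pC M (lexx 0) ler01; exact: le_trans. Qed.

Lemma mode_dbeta x z : 0 <= x -> x <= z -> z <= 1 ->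
  0 <= beta z - beta x <= b2 * (z - x).
Proof.
move=> x0 xz z1; have /andP[h ->] := mode_beta M x0 xz z1.
by rewrite andbT (le_trans _ h)// mulr_ge0// subr_ge0.
Qed.

Lemma mode_uv1 x : 0 <= x -> x <= 1 -> `|u x| <= 1 /\ `|v x| <= 1.
Proof.
move=> x0 x1; have h := mode_le1 M x0 x1.
by split; rewrite ler_norml; apply/andP; split; nra.
Qed.

Lemma mode_lip_sym x z : 0 <= x -> x <= 1 -> 0 <= z -> z <= 1 ->
  `|u z - u x| <= C * `|z - x| /\ `|v z - v x| <= C * `|z - x|.
Proof.
move=> x0 x1 z0 z1; have [xz|/ltW zx] := leP x z.
  by rewrite (ger0_norm (_ : 0 <= z - x)) ?subr_ge0//; have [] := mode_lip M x0 xz z1.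
rewrite distrC (distrC (v z)) (distrC z) (ger0_norm (_ : 0 <= x - z)) ?subr_ge0//.
by have [] := mode_lip M z0 zx x1.
Qed.

(** Uniqueness for the Cauchy problem at 1: y(1) = 0 entails y'(1) = 0, and
Gronwall's lemma applies to |y|^2 + |y'|^2. In the lower bound for the
increments of this function, the squares of the increments of u, v, p and q are
nonnegative, so only the terms that are linear in those increments matter. *)
Lemma mode_y1_neq0 : 0 < u 1 ^+ 2 + v 1 ^+ 2.
Proof.
rewrite lt_neqAle addr_ge0 ?sqr_ge0// andbT; apply/eqP => uv.
have u10 : u 1 = 0 by apply/eqP; rewrite -sqrf_eq0 eq_le sqr_ge0 andbT; nra.
have v10 : v 1 = 0 by apply/eqP; rewrite -sqrf_eq0 eq_le sqr_ge0 andbT; nra.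
have C0 := mode_C_ge0.
pose c := a ^+ 2 - b ^+ 2; pose d := 2 * a * b.
pose E x := u x ^+ 2 + v x ^+ 2 + p x ^+ 2 + q x ^+ 2.
have [s [s0 s1 uvs]] := mode_sup M.
have b20 : 0 <= b2 by exact: le_trans b1_le_b2.
have : E s <= 0; last first.
  by rewrite /E uvs; have := sqr_ge0 (p s); have := sqr_ge0 (q s); lra.
apply: (@backward_gronwall _ E (1 + (`|c| + `|d|) * b2) (4 * C + 4 * C ^+ 2)
  (1 + 2 * C ^+ 2)) => //.
- by rewrite addr_ge0// mulr_ge0// addr_ge0.
- move=> x x0 x1; rewrite /E; have := mode_le1 M x0 x1.
  have : p x ^+ 2 <= C ^+ 2 by have := mode_pC M x0 x1; rewrite ler_norml; nra.
  have : q x ^+ 2 <= C ^+ 2 by have := mode_qC M x0 x1; rewrite ler_norml; nra.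
  have := sqr_ge0 (p x); have := sqr_ge0 (q x).
  have := sqr_ge0 (u x); have := sqr_ge0 (v x); lra.
- move=> x z x0 xz z1; have x1 := le_trans xz z1.
  have [ux vx] := mode_uv1 x0 x1.
  have px := mode_pC M x0 x1; have qx := mode_qC M x0 x1.
  have := mode_du M x0 xz z1; have := mode_dv M x0 xz z1.
  have := mode_dp M x0 xz z1; have := mode_dq M x0 xz z1.
  have /andP := mode_dbeta x0 xz z1.
  rewrite -/c -/d.
  set D := beta z - beta x; set dx := z - x => -[D0 Db].
  set e1 := q z - q x + _; set e2 := p z - p x + _.
  set e3 := v z - v x - _; set e4 := u z - u x - _ => E1 E2 E3 E4.
  have dx0 : 0 <= dx by rewrite subr_ge0.
  have F1 := normM_le qx E1; have F2 := normM_le px E2.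
  have F3 := normM_le vx E3; have F4 := normM_le ux E4.
  (* the increment of E in terms of the Taylor remainders e1, ..., e4 *)
  have dE : E z - E x = 2 * (u x * e4 + v x * e3 + p x * e2 + q x * e1)
     + (u z - u x) ^+ 2 + (v z - v x) ^+ 2 + (p z - p x) ^+ 2 + (q z - q x) ^+ 2
     + 2 * (u x * p x + v x * q x) * dx
     - 2 * (c * (p x * u x + q x * v x) + d * (q x * u x - p x * v x)) * D.
    by rewrite /E /e1 /e2 /e3 /e4 /dx; ring.
  have E0 : 0 <= E x by rewrite /E !addr_ge0// sqr_ge0.
  have G1 : - E x <= 2 * (u x * p x + v x * q x).
    by rewrite /E; have := sqr_ge0 (u x + p x); have := sqr_ge0 (v x + q x); lra.
  have G2 : `|2 * (p x * u x + q x * v x)| <= E x.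
    rewrite ler_norml /E.
    have := sqr_ge0 (u x + p x); have := sqr_ge0 (v x + q x).
    by have := sqr_ge0 (u x - p x); have := sqr_ge0 (v x - q x); lra.
  have G3 : `|2 * (q x * u x - p x * v x)| <= E x.
    rewrite ler_norml /E.
    have := sqr_ge0 (u x + q x); have := sqr_ge0 (v x + p x).
    by have := sqr_ge0 (u x - q x); have := sqr_ge0 (v x - p x); lra.
  have G4 := normM_le (lexx `|c|) G2; have G5 := normM_le (lexx `|d|) G3.
  have H1 : - E x * dx <= 2 * (u x * p x + v x * q x) * dx by rewrite ler_wpM2r.
  have H2 : 2 * (c * (p x * u x + q x * v x) + d * (q x * u x - p x * v x)) * D
      <= (`|c| + `|d|) * E x * (b2 * dx).
    apply: (@le_trans _ _ ((`|c| + `|d|) * E x * D)).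
      rewrite ler_wpM2r//; move: G4 G5; rewrite !ler_norml; lra.
    by rewrite ler_wpM2l// mulr_ge0// addr_ge0.
  rewrite dE.
  have := sqr_ge0 (u z - u x); have := sqr_ge0 (v z - v x).
  have := sqr_ge0 (p z - p x); have := sqr_ge0 (q z - q x).
  move: F1 F2 F3 F4 H1 H2; rewrite !ler_norml.
  set e4' := u x * e4; set e3' := v x * e3.
  set e2' := p x * e2; set e1' := q x * e1.
  lra.
- by rewrite /E u10 v10 (mode_p1 M) (mode_q1 M) u10 v10; lra.
Qed.

(** If b <= 0, then for a <> 0 the function a Im (y' conj(y)), whose
differential is - 2 a^2 b |y|^2 dbeta, is nondecreasing from 0 to - a^2
|y(1)|^2. For a = 0 the same holds of Re (y' conj(y)), whose differential is
|y'|^2 dx + b^2 |y|^2 dbeta and whose value at 1 is b |y(1)|^2. Either way y(1)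
= 0, except for a = b = 0 where this comes from [mode_small]. *)
Lemma mode_Im_gt0 : 0 < b.
Proof.
rewrite ltNge; apply/negP => b0; have y1 := mode_y1_neq0.
have C0 := mode_C_ge0.
pose c := a ^+ 2 - b ^+ 2; pose d := 2 * a * b.
have [a0|a0] := eqVneq a 0.
  have [b00|bn0] := eqVneq b 0.
    by have := mode_small M; rewrite a0 b00 expr0n/= addr0 mulr0 leNgt y1.
  pose N x := p x * u x + q x * v x.
  have : N 0 <= N 1.
    apply: (@quad_nondecreasing _ N (2 * C + 4 * C ^+ 2)) => // x z x0 xz z1.
    have x1 := le_trans xz z1.
    have [ux vx] := mode_uv1 x0 x1.
    have px := mode_pC M x0 x1; have qx := mode_qC M x0 x1.
    have := mode_du M x0 xz z1; have := mode_dv M x0 xz z1.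
    have := mode_dp M x0 xz z1; have := mode_dq M x0 xz z1.
    have [lu lv lp lq] := mode_lip M x0 xz z1.
    have /andP := mode_dbeta x0 xz z1.
    rewrite -/c -/d.
    set D := beta z - beta x; set dx := z - x => -[D0 Db].
    set e1 := q z - q x + _; set e2 := p z - p x + _.
    set e3 := v z - v x - _; set e4 := u z - u x - _ => E1 E2 E3 E4.
    have F1 := normM_le vx E1; have F2 := normM_le ux E2.
    have F3 := normM_le qx E3; have F4 := normM_le px E4.
    have F5 := normM_le lu lp; have F6 := normM_le lv lq.
    have -> : N z - N x = v x * e1 + u x * e2 + q x * e3 + p x * e4
        + (u z - u x) * (p z - p x) + (v z - v x) * (q z - q x)
        + (p x ^+ 2 + q x ^+ 2) * dx - c * (u x ^+ 2 + v x ^+ 2) * D.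
      by rewrite /N /e1 /e2 /e3 /e4 /dx; ring.
    have H1 : 0 <= (p x ^+ 2 + q x ^+ 2) * dx.
      by rewrite mulr_ge0 ?subr_ge0// addr_ge0 ?sqr_ge0.
    have H2 : 0 <= - c * (u x ^+ 2 + v x ^+ 2) * D.
      rewrite mulr_ge0// mulr_ge0 ?addr_ge0 ?sqr_ge0//.
      by rewrite /c a0 expr0n/= sub0r opprK sqr_ge0.
    move: F1 F2 F3 F4 F5 F6 H1 H2; rewrite !ler_norml.
    rewrite (_ : C * dx * (C * dx) = C ^+ 2 * dx ^+ 2); last by ring.
    set e4' := p x * e4; set e3' := q x * e3.
    set e2' := u x * e2; set e1' := v x * e1.
    lra.
  rewrite /N (mode_p0 M) (mode_q0 M) (mode_p1 M) (mode_q1 M) a0 !mul0r !addr0.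
  apply/negP; rewrite -ltNge subr0.
  have bl : b < 0 by rewrite lt_neqAle bn0.
  have := nmulr_rlt0 (u 1 ^+ 2 + v 1 ^+ 2) bl; rewrite y1; lra.
pose Q x := a * (q x * u x - p x * v x).
have : Q 0 <= Q 1.
  apply: (@quad_nondecreasing _ Q (`|a| * (2 * C + 4 * C ^+ 2))) => // x z x0 xz z1.
  have x1 := le_trans xz z1.
  have [ux vx] := mode_uv1 x0 x1.
  have px := mode_pC M x0 x1; have qx := mode_qC M x0 x1.
  have := mode_du M x0 xz z1; have := mode_dv M x0 xz z1.
  have := mode_dp M x0 xz z1; have := mode_dq M x0 xz z1.
  have [lu lv lp lq] := mode_lip M x0 xz z1.
  have /andP := mode_dbeta x0 xz z1.
  rewrite -/c -/d.
  set D := beta z - beta x; set dx := z - x => -[D0 Db].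
  set e1 := q z - q x + _; set e2 := p z - p x + _.
  set e3 := v z - v x - _; set e4 := u z - u x - _ => E1 E2 E3 E4.
  have F1 := normM_le ux E1; have F2 := normM_le vx E2.
  have F3 := normM_le px E3; have F4 := normM_le qx E4.
  have F5 := normM_le lu lq; have F6 := normM_le lv lp.
  pose e := u x * e1 - v x * e2 - p x * e3 + q x * e4
      + (u z - u x) * (q z - q x) - (v z - v x) * (p z - p x).
  have -> : Q z - Q x = a * e - a * d * (u x ^+ 2 + v x ^+ 2) * D.
    by rewrite /Q /e /e1 /e2 /e3 /e4 /dx; ring.
  have H2 : 0 <= - (a * d) * (u x ^+ 2 + v x ^+ 2) * D.
    rewrite mulr_ge0// mulr_ge0 ?addr_ge0 ?sqr_ge0//.
    by rewrite /d; have := sqr_ge0 a; nra.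
  have He : `|e| <= (2 * C + 4 * C ^+ 2) * dx ^+ 2.
    rewrite /e; move: F1 F2 F3 F4 F5 F6; rewrite !ler_norml.
    rewrite (_ : C * dx * (C * dx) = C ^+ 2 * dx ^+ 2); last by ring.
    have := sqr_ge0 C; have := sqr_ge0 dx.
    set e4' := q x * e4; set e3' := p x * e3.
    set e2' := v x * e2; set e1' := u x * e1.
    nra.
  have := normM_le (lexx `|a|) He; rewrite ler_norml; lra.
rewrite /Q (mode_p0 M) (mode_q0 M) (mode_p1 M) (mode_q1 M) !mul0r subrr mulr0.
apply/negP; rewrite -ltNge.
have : 0 < a ^+ 2 by rewrite lt_neqAle eq_sym sqrf_eq0 a0 sqr_ge0.
by move=> /mulr_gt0 /(_ y1); lra.
Qed.

End mode_theory.

(** * Compactness of the modes *)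

Section ultralimit.
Variable R : realType.
Variable U : set_system nat.
Hypothesis UU : UltraFilter U.

Definition ulim (f : nat -> R) (l : R) : Prop := f n @[n --> U] --> l.

(** An ultrafilter on a compact set converges to its cluster point. *)
Lemma ultra_cvg_bounded (f : nat -> R) M : (forall n, `|f n| <= M) ->
  exists l : R, ulim f l.
Proof.
move=> fM.
have fU : (f @ U) `[- M, M]%classic.
  rewrite nbhs_filterE/= /fmap/=; apply: filterE => n.
  by rewrite /= in_itv/= -ler_norml.
have [l [_ lc]] := @segment_compact R (- M) M (f @ U) _ fU.
exists l => A Al.
have [//|UnA] := in_ultra_setVsetC (f @^-1` A) UU.
have [x [xnA xA]] := lc (~` A) A UnA Al.
by [].
Qed.

Lemma ulim_cst c : ulim (fun=> c) c.
Proof. exact: cvg_cst. Qed.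

Lemma ulimD f g l m : ulim f l -> ulim g m -> ulim (fun n => f n + g n) (l + m).
Proof. exact: cvgD. Qed.

Lemma ulimN f l : ulim f l -> ulim (fun n => - f n) (- l).
Proof. exact: cvgN. Qed.

Lemma ulimM f g l m : ulim f l -> ulim g m -> ulim (fun n => f n * g n) (l * m).
Proof. exact: cvgM. Qed.

Lemma ulim_sqr f l : ulim f l -> ulim (fun n => f n ^+ 2) (l ^+ 2).
Proof. by move=> fl; apply: ulimM. Qed.

Lemma ulim_norm f l : ulim f l -> ulim (fun n => `|f n|) `|l|.
Proof. exact: cvg_norm. Qed.

Lemma ulim_le f g l m : ulim f l -> ulim g m -> (forall n, f n <= g n) -> l <= m.
Proof. by move=> fl gm fg; apply: (ler_cvg_to fl gm); apply: filterE. Qed.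

Lemma ulim_eq f g l m : ulim f l -> ulim g m -> (forall n, f n = g n) -> l = m.
Proof.
move=> fl gm fg; apply/eqP; rewrite eq_le.
by rewrite (ulim_le fl gm) ?(ulim_le gm fl)// => n; rewrite fg.
Qed.

Lemma ultra_cvg_bounded_fun (f : nat -> R -> R) M :
  (forall n x, 0 <= x -> x <= 1 -> `|f n x| <= M) ->
  exists g : R -> R, forall x, 0 <= x -> x <= 1 -> ulim (f ^~ x) (g x).
Proof.
move=> fM.
suff /choice[g gE] : forall x : R, exists l : R,
    0 <= x -> x <= 1 -> ulim (f ^~ x) l by exists g.
move=> x; have [[x0 x1]|nx] := pselect (0 <= x /\ x <= 1).
  by have [l lE] := @ultra_cvg_bounded (f ^~ x) M (fun n => fM n x x0 x1); exists l.
by exists 0 => x0 x1; case: nx.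
Qed.

Variables (C b1 b2 A : R) (a_ b_ : nat -> R) (beta_ u_ v_ p_ q_ : nat -> R -> R).
Hypotheses (b1_ge0 : 0 <= b1) (b1_le_b2 : b1 <= b2).
Hypotheses (aA : forall n, `|a_ n| <= A) (bA : forall n, `|b_ n| <= A).
Hypothesis M_ : forall n,
  mode C b1 b2 (a_ n) (b_ n) (beta_ n) (u_ n) (v_ n) (p_ n) (q_ n).

Ltac ulim_tac := repeat first
  [ simple apply ulimD | simple apply ulimN | simple apply ulimM
  | simple apply ulim_sqr | simple apply ulim_norm | solve [auto]
  | simple apply ulim_cst ].

(** Every condition but one compares continuous expressions of values at fixed
points. The exception is the point where |y_n| = 1, which moves with n:
|y_n(x_n)|^2 and |y_n(s)|^2 differ by at most 4 C |x_n - s|, where s is the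
limit of the points x_n. *)
Lemma mode_limit : exists a b beta u v p q,
  [/\ ulim a_ a, ulim b_ b &
      mode C b1 b2 a b beta u v p q].
Proof.
have [a al] := ultra_cvg_bounded aA.
have [b bl] := ultra_cvg_bounded bA.
have [|beta betal] := @ultra_cvg_bounded_fun beta_ b2.
  move=> n x x0 x1.
  have := mode_dbeta b1_ge0 (M_ n) (lexx 0) x0 x1.
  rewrite (mode_beta0 (M_ n)) !subr0 => /andP[B0 Bx]; rewrite ger0_norm//.
  by apply: le_trans Bx _; rewrite ler_piMr// (le_trans b1_ge0).
have [|u ul] := @ultra_cvg_bounded_fun u_ 1.
  by move=> n x x0 x1; have [] := mode_uv1 (M_ n) x0 x1.
have [|v vl] := @ultra_cvg_bounded_fun v_ 1.
  by move=> n x x0 x1; have [] := mode_uv1 (M_ n) x0 x1.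
have [|p pl] := @ultra_cvg_bounded_fun p_ C.
  by move=> n x x0 x1; exact: mode_pC (M_ n) _ x0 x1.
have [|q ql] := @ultra_cvg_bounded_fun q_ C.
  by move=> n x x0 x1; exact: mode_qC (M_ n) _ x0 x1.
have /choice[x_ x_E] n := mode_sup (M_ n).
have [|s sl] := @ultra_cvg_bounded x_ 1.
  by move=> n; have [x0 x1 _] := x_E n; rewrite ger0_norm.
have s0 : 0 <= s.
  apply: (@ulim_le (fun=> 0) x_) => //; first exact: ulim_cst.
  by move=> n; case: (x_E n).
have s1 : s <= 1.
  apply: (@ulim_le x_ (fun=> 1)) => //; first exact: ulim_cst.
  by move=> n; case: (x_E n).
have C0 := mode_C_ge0 (M_ 0%N).
exists a, b, beta, u, v, p, q; split => //; split.
- apply: (@ulim_eq (fun n => beta_ n 0) (fun=> 0)); ulim_tac.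
  by move=> n; exact: mode_beta0 (M_ n).
- move=> x z x0 xz z1; have x1 := le_trans xz z1; have z0 := le_trans x0 xz.
  apply/andP; split.
  + apply: (@ulim_le (fun=> b1 * (z - x)) (fun n => beta_ n z - beta_ n x)).
    * by ulim_tac.
    * by ulim_tac.
    * by move=> n; case/andP: (mode_beta (M_ n) x0 xz z1).
  + apply: (@ulim_le (fun n => beta_ n z - beta_ n x) (fun=> b2 * (z - x))).
    * by ulim_tac.
    * by ulim_tac.
    * by move=> n; case/andP: (mode_beta (M_ n) x0 xz z1).
- have le1 x : 0 <= x -> x <= 1 -> u x ^+ 2 + v x ^+ 2 <= 1.
    move=> x0 x1.
    apply: (@ulim_le (fun n => u_ n x ^+ 2 + v_ n x ^+ 2) (fun=> 1)); ulim_tac.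
    by move=> n; exact: mode_le1 (M_ n) _ x0 x1.
  exists s; split => //; apply/eqP; rewrite eq_le le1//=.
  rewrite -[leRHS]addr0 -(mulr0 (4 * C)) -(normr0 R) -(subrr s).
  apply: (@ulim_le (fun=> 1)
    (fun n => u_ n s ^+ 2 + v_ n s ^+ 2 + 4 * C * `|x_ n - s|)); ulim_tac.
  move=> n; have [x0 x1 uv1] := x_E n.
  have [lu lv] := mode_lip_sym (M_ n) s0 s1 x0 x1.
  have [us vs] := mode_uv1 (M_ n) s0 s1; have [ux vx] := mode_uv1 (M_ n) x0 x1.
  have us2 : `|u_ n (x_ n) + u_ n s| <= 2.
    by rewrite (le_trans (ler_normD _ _))// -[2]/(1 + 1) lerD.
  have vs2 : `|v_ n (x_ n) + v_ n s| <= 2.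
    by rewrite (le_trans (ler_normD _ _))// -[2]/(1 + 1) lerD.
  have := normM_le us2 lu; have := normM_le vs2 lv.
  rewrite !ler_norml; move: uv1; lra.
- move=> x x0 x1.
  apply: (@ulim_le (fun n => u_ n x ^+ 2 + v_ n x ^+ 2) (fun=> 1)); ulim_tac.
  by move=> n; exact: mode_le1 (M_ n) _ x0 x1.
- apply: (@ulim_eq (fun n => p_ n 0) (fun=> 0)); ulim_tac.
  by move=> n; exact: mode_p0 (M_ n).
- apply: (@ulim_eq (fun n => q_ n 0) (fun=> 0)); ulim_tac.
  by move=> n; exact: mode_q0 (M_ n).
- apply: (@ulim_eq (fun n => p_ n 1) (fun n => b_ n * u_ n 1 + a_ n * v_ n 1)); ulim_tac.
  by move=> n; exact: mode_p1 (M_ n).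
- apply: (@ulim_eq (fun n => q_ n 1) (fun n => b_ n * v_ n 1 - a_ n * u_ n 1)); ulim_tac.
  by move=> n; exact: mode_q1 (M_ n).
- apply: (@ulim_le (fun n => u_ n 1 ^+ 2 + v_ n 1 ^+ 2)
    (fun n => C * (a_ n ^+ 2 + b_ n ^+ 2))); ulim_tac.
  by move=> n; exact: mode_small (M_ n).
- move=> x x0 x1; apply: (@ulim_le (fun n => `|p_ n x|) (fun=> C)); ulim_tac.
  by move=> n; exact: mode_pC (M_ n) _ x0 x1.
- move=> x x0 x1; apply: (@ulim_le (fun n => `|q_ n x|) (fun=> C)); ulim_tac.
  by move=> n; exact: mode_qC (M_ n) _ x0 x1.
- move=> x z x0 xz z1; have x1 := le_trans xz z1; have z0 := le_trans x0 xz.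
  split.
  + apply: (@ulim_le (fun n => `|u_ n z - u_ n x|) (fun=> C * (z - x))); ulim_tac.
    by move=> n; case: (mode_lip (M_ n) x0 xz z1).
  + apply: (@ulim_le (fun n => `|v_ n z - v_ n x|) (fun=> C * (z - x))); ulim_tac.
    by move=> n; case: (mode_lip (M_ n) x0 xz z1).
  + apply: (@ulim_le (fun n => `|p_ n z - p_ n x|) (fun=> C * (z - x))); ulim_tac.
    by move=> n; case: (mode_lip (M_ n) x0 xz z1).
  + apply: (@ulim_le (fun n => `|q_ n z - q_ n x|) (fun=> C * (z - x))); ulim_tac.
    by move=> n; case: (mode_lip (M_ n) x0 xz z1).
- move=> x z x0 xz z1; have x1 := le_trans xz z1; have z0 := le_trans x0 xz.
  apply: (ulim_le _ _ (fun n => mode_du (M_ n) x0 xz z1)); ulim_tac.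
- move=> x z x0 xz z1; have x1 := le_trans xz z1; have z0 := le_trans x0 xz.
  apply: (ulim_le _ _ (fun n => mode_dv (M_ n) x0 xz z1)); ulim_tac.
- move=> x z x0 xz z1; have x1 := le_trans xz z1; have z0 := le_trans x0 xz.
  apply: (ulim_le _ _ (fun n => mode_dp (M_ n) x0 xz z1)); ulim_tac.
- move=> x z x0 xz z1; have x1 := le_trans xz z1; have z0 := le_trans x0 xz.
  apply: (ulim_le _ _ (fun n => mode_dq (M_ n) x0 xz z1)); ulim_tac.
Qed.
End ultralimit.

(** * Integrals of bounded functions over subintervals of [0, 1] *)

Section bounded_measurable.
Variable R : realType.
Implicit Types (f g : R -> R) (x y z M C : R).

(** Functions are only constrained on [0, 1], the sole place where the values of
eigenfunctions are prescribed. *)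
Definition bmeas f := measurable_fun (`[0, 1]%classic : set R) f /\
  exists M, forall x, 0 <= x -> x <= 1 -> `|f x| <= M.

Lemma bmeas_cst c : bmeas (cst c).
Proof. by split; [exact: measurable_cst|exists `|c|]. Qed.

Lemma bmeasD f g : bmeas f -> bmeas g -> bmeas (fun x => f x + g x).
Proof.
move=> [mf [M fM]] [mg [N gN]]; split; first exact: measurable_funD.
by exists (M + N) => x x0 x1; rewrite (le_trans (ler_normD _ _))// lerD ?fM ?gN.
Qed.

Lemma bmeasM f g : bmeas f -> bmeas g -> bmeas (fun x => f x * g x).
Proof.
move=> [mf [M fM]] [mg [N gN]]; split; first exact: measurable_funM.
by exists (M * N) => x x0 x1; apply: normM_le; [exact: fM|exact: gN].
Qed.

Lemma bmeasN f : bmeas f -> bmeas (fun x => - f x).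
Proof.
move=> [mf [M fM]]; split; first exact: measurable_funN.
by exists M => x x0 x1; rewrite normrN fM.
Qed.

Lemma bmeasB f g : bmeas f -> bmeas g -> bmeas (fun x => f x - g x).
Proof. by move=> bf bg; apply: bmeasD => //; exact: bmeasN. Qed.

Lemma bmeas_continuous f : {within `[0, 1], continuous f} -> bmeas f.
Proof.
move=> cf; split.
  by apply: subspace_continuous_measurable_fun => //; exact: measurable_itv.
have /compact_bounded[M [_ fM]] := continuous_compact cf (@segment_compact _ 0 1).
exists (M + 1) => x x0 x1; apply: fM; first by rewrite ltrDl.
by exists x => //=; rewrite in_itv/= x0.
Qed.

Lemma within_continuousP f : {within `[0, 1], continuous f} <->
  (forall x e, 0 <= x -> x <= 1 -> 0 < e -> exists2 d, 0 < d &
     forall z, 0 <= z -> z <= 1 -> `|x - z| < d -> `|f x - f z| <= e).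
Proof.
split=> [/subspace_continuousP cf x e x0 x1 e0|H].
  have xI : `[0, 1]%classic x by rewrite /= in_itv/= x0.
  have /(@cvgrPdist_le _ R^o) /(_ _ e0) [d /= d0 dH] := cf x xI.
  by exists d => // z z0 z1 xz; apply: dH => //=; rewrite in_itv/= z0.
apply/subspace_continuousP => x /=; rewrite in_itv/= => /andP[x0 x1].
apply/(@cvgrPdist_le _ R^o) => e e0.
have [d d0 dH] := H x e x0 x1 e0.
by exists d => //= z /= xz; rewrite in_itv/= => /andP[z0 z1]; exact: dH.
Qed.

Definition lip01 C f := forall x z, 0 <= x -> x <= z -> z <= 1 ->
  `|f z - f x| <= C * (z - x).

Lemma lip01_ge0 C f : lip01 C f -> 0 <= C.
Proof.
by move=> /(_ 0 1 (lexx _) ler01 (lexx _)); rewrite subr0 mulr1; exact: le_trans.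
Qed.

Lemma lip01_continuous C f : lip01 C f -> {within `[0, 1], continuous f}.
Proof.
move=> Lf; apply/within_continuousP => x e x0 x1 e0.
have C0 := lip01_ge0 Lf.
have C1 : 0 < C + 1 by rewrite ltr_wpDl.
exists (e / (C + 1)); first by rewrite divr_gt0.
move=> z z0 z1; rewrite ltr_pdivlMr// => xz.
have h : `|f x - f z| <= C * `|x - z|.
  have [xz'|/ltW zx] := leP x z.
    rewrite distrC (distrC x) (ger0_norm (_ : 0 <= z - x)) ?subr_ge0//.
    exact: Lf.
  rewrite (ger0_norm (_ : 0 <= x - z)) ?subr_ge0//.
  exact: Lf.
by have := normr_ge0 (x - z); nra.
Qed.

Local Notation mu := (@lebesgue_measure R).
Definition intg f x z : R := \int[mu]_(t in `[x, z]) f t.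

Section interval.
Variables (x z : R).
Hypotheses (x0 : 0 <= x) (xz : x <= z) (z1 : z <= 1).

Let mxz : measurable (`[x, z]%classic : set R).
Proof. exact: measurable_itv. Qed.

Let sub t : `[x, z]%classic t -> [/\ 0 <= t, t <= 1, x <= t & t <= z].
Proof.
rewrite /= in_itv/= => /andP[xt tz].
by split => //; [exact: le_trans xt|exact: le_trans z1].
Qed.

Lemma bmeas_integrable f : bmeas f -> mu.-integrable `[x, z] (EFin \o f).
Proof.
move=> [mf [M fM]]; apply: measurable_bounded_integrable => //.
- by rewrite [X in (X < _)%E]lebesgue_measure_itv/=; case: ifPn => _; rewrite ?ltry.
- apply: measurable_funS mf; first exact: measurable_itv.
  by move=> t /sub[? ? _ _]; rewrite /= in_itv/=; apply/andP.
- exists M; split; rewrite ?num_real// => N MN t /sub[t0 t1 _ _] /=.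
  by rewrite (le_trans (fM _ t0 t1))// ltW.
Qed.

Lemma intgD f g : bmeas f -> bmeas g ->
  intg (fun t => f t + g t) x z = intg f x z + intg g x z.
Proof. by move=> bf bg; apply: RintegralD => //; exact: bmeas_integrable. Qed.

Lemma intgB f g : bmeas f -> bmeas g ->
  intg (fun t => f t - g t) x z = intg f x z - intg g x z.
Proof. by move=> bf bg; apply: RintegralB => //; exact: bmeas_integrable. Qed.

Lemma intgZ k f : bmeas f -> intg (fun t => k * f t) x z = k * intg f x z.
Proof. by move=> bf; apply: RintegralZl => //; exact: bmeas_integrable. Qed.

Lemma intg_cst k : intg (fun=> k) x z = k * (z - x).
Proof.
rewrite /intg Rintegral_cst//; congr (_ * _).
rewrite [X in fine X]lebesgue_measure_itv/= lte_fin.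
by case: ltgtP xz => // ->; rewrite subrr.
Qed.

Lemma eq_intg f g : (forall t, x <= t -> t <= z -> f t = g t) -> intg f x z = intg g x z.
Proof.
by move=> fg; apply: eq_Rintegral => t /[!inE] /sub[_ _ xt tz]; exact: fg.
Qed.

Lemma intg_le_norm f g : bmeas f -> bmeas g ->
  (forall t, x <= t -> t <= z -> `|f t| <= g t) -> `|intg f x z| <= intg g x z.
Proof.
move=> bf bg fg.
apply: (le_trans (le_normr_Rintegral _ (bmeas_integrable bf))) => //.
apply: le_Rintegral => //.
- by have := integrable_norm (bmeas_integrable bf).
- exact: bmeas_integrable.
- by move=> t /sub[_ _ xt tz]; exact: fg.
Qed.

Lemma intg_le f M : bmeas f ->
  (forall t, x <= t -> t <= z -> `|f t| <= M) -> `|intg f x z| <= M * (z - x).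
Proof.
by move=> bf fM; rewrite -intg_cst; apply: intg_le_norm => //; exact: bmeas_cst.
Qed.

Lemma intg_taylor f C : bmeas f -> lip01 C f ->
  `|intg f x z - f x * (z - x)| <= C * (z - x) ^+ 2.
Proof.
move=> bf fC; rewrite -intg_cst -intgB//; last exact: bmeas_cst.
rewrite expr2 mulrA; apply: intg_le.
  by apply: bmeasB => //; exact: bmeas_cst.
have C0 := lip01_ge0 fC.
move=> t xt tz; apply: le_trans (fC x t x0 xt (le_trans tz z1)) _.
by rewrite ler_wpM2l// lerD2r.
Qed.

End interval.

Lemma intg_chasles f x y z : bmeas f -> 0 <= x -> x <= y -> y <= z -> z <= 1 ->
  intg f x y + intg f y z = intg f x z.
Proof.
move=> bf x0 xy yz z1; have xz := le_trans xy yz.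
suff -> : intg f y z = intg f x z - intg f x y by rewrite subrKC.
rewrite [in RHS]/intg Rintegral_itvB ?bnd_simp//; last exact: bmeas_integrable.
rewrite Rintegral_itv_obnd_cbnd//.
apply: integrableS (bmeas_integrable x0 z1 bf) => //; try exact: measurable_itv.
by apply: subset_itvr; rewrite bnd_simp.
Qed.

Lemma intg_point f x : intg f x x = 0.
Proof. by rewrite /intg set_itv1 Rintegral_set1. Qed.

Lemma intg_lip f M : bmeas f -> (forall x, 0 <= x -> x <= 1 -> `|f x| <= M) ->
  lip01 M (intg f 0).
Proof.
move=> bf fM x z x0 xz z1.
rewrite -(intg_chasles bf (lexx 0) x0 xz z1) addrC addKr.
apply: intg_le => // t xt tz; apply: fM.
- exact: le_trans xt.
- exact: le_trans z1.
Qed.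

(** The difference of F and of the integral of f has increments of quadratic
size, so it is constant. *)
Lemma taylor_intg F f C C' : lip01 C f ->
  (forall x z, 0 <= x -> x <= z -> z <= 1 ->
     `|F z - F x - f x * (z - x)| <= C' * (z - x) ^+ 2) ->
  forall x z, 0 <= x -> x <= z -> z <= 1 -> F z - F x = intg f x z.
Proof.
move=> fC FC; have bf := bmeas_continuous (lip01_continuous fC).
have E x : 0 <= x -> x <= 1 -> F x - intg f 0 x = F 0 - intg f 0 0.
  move=> x0 x1.
  apply: (@quad_constant _ (fun x => F x - intg f 0 x) (C + C')) => // s t s0 st t1.
  have := FC s t s0 st t1; have := intg_taylor s0 st t1 bf fC.
  by rewrite -(intg_chasles bf (lexx 0) s0 st t1) !ler_norml; lra.
move=> x z x0 xz z1.
have := E x x0 (le_trans xz z1); have := E z (le_trans x0 xz) z1.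
by rewrite -(intg_chasles bf (lexx 0) x0 xz z1); lra.
Qed.

Lemma intg_oo f : bmeas f -> \int[mu]_(t in (`]0, 1[ : set R)) f t = intg f 0 1.
Proof.
move=> bf; have i01 := bmeas_integrable (lexx 0) (lexx 1) bf.
rewrite Rintegral_itv_bndo_bndc ?Rintegral_itv_obnd_cbnd//.
- apply: integrableS i01 => //; try exact: measurable_itv.
  by apply: subset_itv; rewrite bnd_simp.
- apply: integrableS i01 => //; try exact: measurable_itv.
  by apply: subset_itv; rewrite bnd_simp.
Qed.

End bounded_measurable.

(** * Weak derivatives and integrals *)

Section weak.
Variable R : realType.
Implicit Types (f g phi : R -> R) (x y z s t e d M C : R).

Lemma continuous_within01 f : continuous f -> {within `[0, 1], continuous f}.
Proof. exact: continuous_subspaceT. Qed.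

Lemma test_fun_intg phi x z : test_fun phi -> 0 <= x -> x <= z -> z <= 1 ->
  intg (derive1 phi) x z = phi z - phi x.
Proof.
move=> [dphi cphi _] x0; rewrite le_eqVlt => /predU1P[<-|xz] z1.
  by rewrite intg_point subrr.
have cp : continuous phi.
  by move=> t; apply: differentiable_continuous; exact/derivable1_diffP.
have cphi' : {within `[x, z], continuous (derive1 phi)}.
  exact: continuous_subspaceT.
have dxz : derivable_oo_LRcontinuous phi x z.
  by split=> [t _||]; [exact: dphi|apply: cvg_within_filter; exact: cp..].
have eqd : {in `]x, z[, derive1 phi =1 derive1 phi} by move=> t _.
by rewrite /intg /Rintegral (continuous_FTC2 xz cphi' dxz eqd).
Qed.

Lemma test_fun_lip phi : test_fun phi -> exists2 M,
  forall x, 0 <= x -> x <= 1 -> `|derive1 phi x| <= M & lip01 M phi.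
Proof.
move=> tphi; have [dphi cphi _] := tphi.
have bphi := bmeas_continuous (continuous_within01 cphi).
have [_ [M M1]] := bphi; exists M => // x z x0 xz z1.
rewrite -(test_fun_intg tphi x0 xz z1); apply: intg_le => // t xt tz.
by apply: M1; [exact: le_trans xt|exact: le_trans z1].
Qed.

Lemma test_fun_boundary phi : test_fun phi -> phi 0 = 0 /\ phi 1 = 0.
Proof.
move=> [_ _ [a [b [a0 b1 ab]]]]; split; apply: ab; rewrite in_itv/= negb_and -!ltNge.
- by rewrite a0.
- by rewrite b1 orbT.
Qed.

(** Integration by parts for a Lipschitz function f and a test function phi. The
function f phi - \int (f phi' + g phi) has quadratic increments, hence takes the
same value at 0 and at 1, where phi vanishes. *)
Lemma intg_weak_deriv f g : bmeas g ->
  (forall x, 0 <= x -> x <= 1 -> f x = f 0 + intg g 0 x) -> weak_deriv f g.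
Proof.
move=> bg fg phi tphi.
have [M phiM phil] := test_fun_lip tphi.
have [phi0 phi1] := test_fun_boundary tphi.
have [dphi cphi _] := tphi.
have bphi' := bmeas_continuous (continuous_within01 cphi).
have bphi := bmeas_continuous (lip01_continuous phil).
have [_ [N gN]] := bg.
have dfE x z : 0 <= x -> x <= z -> z <= 1 -> f z - f x = intg g x z.
  move=> x0 xz z1; rewrite (fg x)// ?(le_trans xz)// (fg z) ?(le_trans x0)//.
  by rewrite -(intg_chasles bg (lexx 0) x0 xz z1); ring.
have fl : lip01 N f.
  move=> x z x0 xz z1; rewrite dfE//; apply: intg_le => // t xt tz; apply: gN.
  - exact: le_trans xt.
  - exact: le_trans z1.
have bf := bmeas_continuous (lip01_continuous fl).
pose k x := f x * derive1 phi x + g x * phi x.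
have bk : bmeas k by apply: bmeasD; apply: bmeasM.
pose H x := f x * phi x - intg k 0 x.
have : H 1 = H 0.
  apply: (@quad_constant _ H (2 * (M * N))) => // x z x0 xz z1.
  have -> : H z - H x = intg (fun t => phi z * g t + f x * derive1 phi t - k t) x z.
    rewrite intgB//; last by apply: bmeasD; apply: bmeasM => //; exact: bmeas_cst.
    rewrite intgD//; last 2 first.
      by apply: bmeasM => //; exact: bmeas_cst.
      by apply: bmeasM => //; exact: bmeas_cst.
    rewrite !intgZ// -dfE// test_fun_intg// /H -(intg_chasles bk (lexx 0) x0 xz z1).
    by ring.
  rewrite expr2 mulrA; apply: intg_le => //.
    by apply: bmeasB => //; apply: bmeasD; apply: bmeasM => //; exact: bmeas_cst.
  move=> t xt tz; rewrite /k.
  have t0 := le_trans x0 xt; have t1 := le_trans tz z1.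
  have -> : phi z * g t + f x * derive1 phi t - (f t * derive1 phi t + g t * phi t) =
    (phi z - phi t) * g t - (f t - f x) * derive1 phi t by ring.
  have M0 : 0 <= M by exact: le_trans (phiM _ t0 t1).
  have N0 : 0 <= N by exact: le_trans (gN _ t0 t1).
  have h1 : `|phi z - phi t| <= M * (z - x).
    by apply: le_trans (phil _ _ t0 tz z1) _; rewrite ler_wpM2l// lerD2l lerN2.
  have h2 : `|f t - f x| <= N * (z - x).
    by apply: le_trans (fl _ _ x0 xt t1) _; rewrite ler_wpM2l// lerD2r.
  have := normM_le h1 (gN _ t0 t1); have := normM_le h2 (phiM _ t0 t1).
  by rewrite !ler_norml; lra.
rewrite /H phi0 phi1 !mulr0 intg_point subr0 sub0r => /eqP; rewrite oppr_eq0 => /eqP.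
rewrite /k intgD//; try exact: bmeasM.
rewrite !intg_oo; try exact: bmeasM.
by move/eqP; rewrite addr_eq0 => /eqP.
Qed.

Definition posr r : R := Num.max 0 r.

Lemma posr_sq x y : `|posr y ^+ 2 - posr x ^+ 2 - 2 * posr x * (y - x)| <= (y - x) ^+ 2.
Proof.
rewrite ler_norml /posr; have yx := sqr_ge0 (y - x).
by case: (leP 0 x) => x0; case: (leP 0 y) => y0; apply/andP; split; nra.
Qed.

Lemma posr_lip x y : `|posr y - posr x| <= `|y - x|.
Proof.
rewrite ler_norml /posr; have := ler_norm (y - x); have := lerNnormlW (lexx `|y - x|).
by case: (leP 0 x) => x0; case: (leP 0 y) => y0; lra.
Qed.

(** A second difference of the positive part: a tent of height d over [- d, d].
*)
Definition tent d r := posr (r + d) - 2 * posr r + posr (r - d).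

(** The primitive of [tent] that vanishes on the left of - d; its explicit form
makes it evident that it is constant, equal to d^2, on the right of d. *)
Definition bump d r := (posr (r + d) ^+ 2 - 2 * posr r ^+ 2 + posr (r - d) ^+ 2) / 2.

Lemma bump_quad d x y : `|bump d y - bump d x - tent d x * (y - x)| <= 2 * (y - x) ^+ 2.
Proof.
have := posr_sq (x + d) (y + d); have := posr_sq x y; have := posr_sq (x - d) (y - d).
rewrite (_ : y + d - (x + d) = y - x); last by ring.
rewrite (_ : y - d - (x - d) = y - x); last by ring.
by rewrite /bump /tent !ler_norml; lra.
Qed.

Lemma tent_lip d x y : `|tent d y - tent d x| <= 4 * `|y - x|.
Proof.
have := posr_lip (x + d) (y + d); have := posr_lip x y; have := posr_lip (x - d) (y - d).
rewrite (_ : y + d - (x + d) = y - x); last by ring.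
rewrite (_ : y - d - (x - d) = y - x); last by ring.
by rewrite /tent !ler_norml; lra.
Qed.

Lemma tent_ge0 d r : 0 <= d -> 0 <= tent d r.
Proof.
move=> d0; rewrite /tent /posr.
by case: (leP 0 (r + d)); case: (leP 0 r); case: (leP 0 (r - d)); lra.
Qed.

Lemma tent_eq0 d r : 0 <= d -> d <= `|r| -> tent d r = 0.
Proof.
move=> d0; rewrite ler_normr /tent /posr => /orP[] rd;
by case: (leP 0 (r + d)); case: (leP 0 r); case: (leP 0 (r - d)); lra.
Qed.

Lemma bumpl d r : 0 <= d -> r <= - d -> bump d r = 0.
Proof.
move=> d0 rd; rewrite /bump /posr.
by case: (leP 0 (r + d)); case: (leP 0 r); case: (leP 0 (r - d)); nra.
Qed.

Lemma bumpr d r : 0 <= d -> d <= r -> bump d r = d ^+ 2.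
Proof.
move=> d0 rd; rewrite /bump /posr.
by case: (leP 0 (r + d)); case: (leP 0 r); case: (leP 0 (r - d)); nra.
Qed.

Lemma quad_is_derive f g C :
  (forall x y, `|f y - f x - g x * (y - x)| <= C * (y - x) ^+ 2) ->
  forall x, is_derive (x : R) 1 (f : R -> R) (g x).
Proof.
move=> fg x.
have C0 : 0 <= C.
  by have := fg 0 1; rewrite subr0 expr1n !mulr1; exact: le_trans.
have cv : (fun h => h^-1 *: ((f \o shift x) (h *: 1) - f x)) @ 0^' --> g x.
  apply/(@cvgrPdist_le _ R^o) => e e0; near=> h.
  have h0 : h != 0 by near: h; exact: nbhs_dnbhs_neq.
  have he : `|h| <= e / (C + 1).
    near: h; apply: dnbhs0_le.
    by rewrite divr_gt0// ltr_wpDl.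
  have := fg x (h + x); rewrite addrK => H.
  rewrite -[h%:A]/(h * 1) mulr1 /= -normrN opprB -(ler_pM2r (_ : 0 < `|h|)) ?normr_gt0//.
  rewrite -normrM mulrBl -[_ *: _]/(h^-1 * _) mulrAC mulVf// mul1r mulrC.
  rewrite (mulrC h) in H *; apply: le_trans H _.
  rewrite -real_normK ?num_real// expr2 mulrA ler_wpM2r//.
  rewrite ler_pdivlMr// in he; last by rewrite ltr_wpDl.
  by have := normr_ge0 h; lra.
by apply: DeriveDef; [apply/cvg_ex; exists (g x)|exact/cvg_lim].
Unshelve. all: by end_near. Qed.

(** A test function whose derivative is a tent at s minus the same tent at t:
tested against it, a function of zero weak derivative has equal averages near s
and t. *)
Definition dipole d s t x := bump d (x - s) - bump d (x - t).

Lemma dipole_derive d s t x :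
  is_derive (x : R) 1 (dipole d s t : R -> R) (tent d (x - s) - tent d (x - t)).
Proof.
apply: (@quad_is_derive _ (fun x => tent d (x - s) - tent d (x - t)) 4).
move=> {}x y; have := bump_quad d (x - s) (y - s); have := bump_quad d (x - t) (y - t).
rewrite (_ : y - s - (x - s) = y - x); last by ring.
rewrite (_ : y - t - (x - t) = y - x); last by ring.
by rewrite /dipole !ler_norml; lra.
Qed.

Lemma derive1_dipole d s t :
  derive1 (dipole d s t) = fun x => tent d (x - s) - tent d (x - t).
Proof.
by apply/funext => x; rewrite derive1E; have [_ ->] := dipole_derive d s t x.
Qed.

Lemma dipole_test d s t e : 0 < d -> d < e -> e <= s -> s <= 1 - e ->
  e <= t -> t <= 1 - e -> test_fun (dipole d s t).
Proof.
move=> d0 de es s1 et t1; split.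
- by move=> x; have [] := dipole_derive d s t x.
- rewrite derive1_dipole => x; apply/(@cvgrPdist_le _ R^o) => r r0; near=> z.
  have xz : `|x - z| <= r / 8.
    by near: z; apply: cvgr_dist_le; [exact: cvg_id|rewrite divr_gt0].
  have := tent_lip d (z - s) (x - s); have := tent_lip d (z - t) (x - t).
  rewrite (_ : x - s - (z - s) = x - z); last by ring.
  rewrite (_ : x - t - (z - t) = x - z); last by ring.
  by rewrite !ler_norml; move: xz; lra.
- exists (e - d), (1 - e + d); split; [lra|lra|].
  move=> x; rewrite in_itv/= negb_and -!ltNge => /orP[] h.
  + by rewrite /dipole !bumpl ?subrr//; lra.
  + by rewrite /dipole !bumpr ?subrr//; lra.
Unshelve. all: by end_near. Qed.

Section tent_integral.
Variables (d s : R).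
Hypotheses (d0 : 0 < d) (ds : d <= s) (s1 : s <= 1 - d).

Lemma tent_lip01 : lip01 4 (fun x => tent d (x - s)).
Proof.
move=> x z x0 xz z1; have := tent_lip d (x - s) (z - s).
rewrite (_ : z - s - (x - s) = z - x); last by ring.
by rewrite (ger0_norm (_ : 0 <= z - x))// subr_ge0.
Qed.

Lemma bmeas_tent : bmeas (fun x => tent d (x - s)).
Proof. exact: bmeas_continuous (lip01_continuous tent_lip01). Qed.

Lemma intg_tent : intg (fun x => tent d (x - s)) 0 1 = d ^+ 2.
Proof.
rewrite -(@taylor_intg _ (fun x => bump d (x - s)) _ _ 2 tent_lip01)//.
  rewrite (@bumpr d (1 - s)); try by move: d0 ds s1; lra.
  by rewrite (@bumpl d (0 - s)) ?subr0//; move: d0 ds s1; lra.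
move=> x z x0 xz z1; have := bump_quad d (x - s) (z - s).
by rewrite (_ : z - s - (x - s) = z - x)//; ring.
Qed.

Lemma intg_tent_approx (h : R -> R) e : bmeas h -> 0 <= e ->
  (forall x, 0 <= x -> x <= 1 -> `|s - x| < d -> `|h s - h x| <= e) ->
  `|intg (fun x => h x * tent d (x - s)) 0 1 - h s * d ^+ 2| <= e * d ^+ 2.
Proof.
move=> bh e0 he; have bt := bmeas_tent.
rewrite -intg_tent -!intgZ// -intgB//; last 2 first.
- by apply: bmeasM.
- by apply: bmeasM => //; exact: bmeas_cst.
apply: intg_le_norm => //.
- by apply: bmeasB; apply: bmeasM => //; exact: bmeas_cst.
- by apply: bmeasM => //; exact: bmeas_cst.
move=> x x0 x1; rewrite -mulrBl normrM (ger0_norm (tent_ge0 _ (ltW d0))).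
have [xd|xd] := ltP `|s - x| d.
  by apply: ler_wpM2r; [exact: tent_ge0 (ltW d0)|rewrite distrC; exact: he].
by rewrite tent_eq0 ?(ltW d0) ?mulr0// distrC.
Qed.

End tent_integral.

(** Lemma of du Bois-Reymond: the averages of h near two interior points agree
by testing against a dipole, and they approximate the values of h when the tents
shrink; the end points follow by continuity. *)
Lemma weak_deriv0_constant (h : R -> R) : {within `[0, 1], continuous h} ->
  (forall phi, test_fun phi -> intg (fun x => h x * derive1 phi x) 0 1 = 0) ->
  forall x, 0 <= x -> x <= 1 -> h x = h 0.
Proof.
move=> ch h0; have bh := bmeas_continuous ch; move/within_continuousP in ch.
have inner s t : 0 < s -> s < 1 -> 0 < t -> t < 1 -> `|h s - h t| = 0.
  move=> s0 s1 t0 t1; apply/eqP; rewrite eq_le normr_ge0 andbT.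
  apply/ler_addgt0Pl => e e0; rewrite addr0.
  have e20 : 0 < e / 2 by rewrite divr_gt0.
  have [d1 d10 H1] := ch s (e / 2) (ltW s0) (ltW s1) e20.
  have [d2 d20 H2] := ch t (e / 2) (ltW t0) (ltW t1) e20.
  have [r r0 [rs rs1 rt rt1]] : exists2 r, 0 < r &
      [/\ r <= s, s <= 1 - r, r <= t & t <= 1 - r].
    exists (Num.min (Num.min s t) (Num.min (1 - s) (1 - t))).
      by rewrite !lt_min s0 t0 !subr_gt0 s1 t1.
    by split; rewrite 1?lerBrDr 1?addrC -?lerBrDr ge_min !ge_min lexx ?orbT.
  have [d d0 [dr dd1 dd2]] : exists2 d, 0 < d & [/\ d < r, d <= d1 & d <= d2].
    exists (Num.min (r / 2) (Num.min d1 d2)).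
      by rewrite !lt_min d10 d20 divr_gt0.
    split; last 2 first.
    - by rewrite !ge_min lexx orbT.
    - by rewrite !ge_min lexx !orbT.
    - by rewrite gt_min; apply/orP; left; lra.
  have ds : d <= s by lra. have s1d : s <= 1 - d by lra.
  have dt : d <= t by lra. have t1d : t <= 1 - d by lra.
  have As := intg_tent_approx d0 ds s1d bh (ltW e20)
    (fun x lo hi sx => H1 x lo hi (lt_le_trans sx dd1)).
  have At := intg_tent_approx d0 dt t1d bh (ltW e20)
    (fun x lo hi sx => H2 x lo hi (lt_le_trans sx dd2)).
  have := h0 _ (dipole_test d0 dr rs rs1 rt rt1).
  rewrite derive1_dipole.
  under eq_fun do rewrite mulrBr.
  rewrite intgB//; last 2 first.
  - by apply: bmeasM => //; exact: bmeas_tent.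
  - by apply: bmeasM => //; exact: bmeas_tent.
  move=> /eqP; rewrite subr_eq0 => /eqP E; move: As At; rewrite E => As At.
  have dd0 : 0 < d ^+ 2 by rewrite exprn_gt0.
  rewrite -(ler_pM2r dd0) -[in leLHS](ger0_norm (ltW dd0)) -normrM.
  by move: As At; rewrite !ler_norml; lra.
have bd x0 : 0 <= x0 -> x0 <= 1 -> h x0 = h (1 / 2).
  move=> x00 x01; apply/eqP; rewrite -subr_eq0 -normr_eq0 eq_le normr_ge0 andbT.
  apply/ler_addgt0Pl => e e0; rewrite addr0.
  have [d d0 H] := ch x0 e x00 x01 e0.
  (* a point of ]0, 1[ at distance less than d of x0 *)
  have [z [z0 z1 zd]] : exists z, [/\ 0 < z, z < 1 & `|x0 - z| < d].
    pose r := Num.min (d / 2) (1 / 2).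
    have r0 : 0 < r by rewrite lt_min !divr_gt0.
    have rd : r < d by rewrite gt_min; apply/orP; left; lra.
    have r1 : r <= 1 / 2 by rewrite ge_min lexx orbT.
    have [xh|xh] := leP x0 (1 / 2).
    + by exists (x0 + r / 2); split; [lra|lra|rewrite ltr_norml; lra].
    + by exists (x0 - r / 2); split; [lra|lra|rewrite ltr_norml; lra].
  have h01 : (0 : R) < 1 / 2 by lra.
  have h11 : (1 : R) / 2 < 1 by lra.
  have /eqP := inner z (1 / 2) z0 z1 h01 h11.
  rewrite normr_eq0 subr_eq0 => /eqP <-.
  by apply: H => //; exact: ltW.
by move=> x x0 x1; rewrite bd// [RHS]bd.
Qed.

(** The primitive of g also has weak derivative g, so its difference with f has
zero weak derivative. *)
Lemma weak_deriv_intg f g : {within `[0, 1], continuous f} -> bmeas g ->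
  weak_deriv f g -> forall x, 0 <= x -> x <= 1 -> f x = f 0 + intg g 0 x.
Proof.
move=> cf bg fg x x0 x1.
have [_ [N gN]] := bg.
have cG : {within `[0, 1], continuous (intg g 0)}.
  exact: lip01_continuous (intg_lip bg gN).
have bf := bmeas_continuous cf; have bG := bmeas_continuous cG.
have := @weak_deriv0_constant (fun x => f x - intg g 0 x) _ _ x x0 x1.
rewrite intg_point subr0 => /(_ _ _) <-.
- by rewrite subrK.
- by apply: within_continuousB.
move=> phi tphi; have [dphi cphi _] := tphi.
have bphi' := bmeas_continuous (continuous_within01 cphi).
have [M _ phil] := test_fun_lip tphi.
have bphi := bmeas_continuous (lip01_continuous phil).
have Gg : weak_deriv (intg g 0) g.
  by apply: intg_weak_deriv => // z z0 z1; rewrite intg_point add0r.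
have := fg phi tphi; have := Gg phi tphi; rewrite !intg_oo; try exact: bmeasM.
under [in X in _ -> _ -> X]eq_fun do rewrite mulrBl.
rewrite intgB//; try exact: bmeasM.
by move=> -> ->; rewrite subrr.
Qed.

End weak.

(** * Densities of functions with bounded slopes *)

Section cumulative.
Variable R : realType.
Implicit Types F G f : R -> R.

Lemma contraction_cumulative F : {homo F : x y / x <= y} ->
  (forall x y : R, x <= y -> F y - F x <= y - x) ->
  exists G : cumulative R R, F = G :> (R -> R).
Proof.
move=> Fnd F1.
have Fc : continuous F.
  move=> x; apply/(@cvgrPdist_le _ R^o) => e e0; near=> t.
  have : `|x - t| <= e by near: t; apply: cvgr_dist_le => //; exact: cvg_id.
  apply: le_trans.
  have [xt|/ltW tx] := leP x t.
    by rewrite distrC (distrC x) !ger0_norm ?subr_ge0 ?F1 ?Fnd.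
  by rewrite !ger0_norm ?subr_ge0 ?F1 ?Fnd.
pose H := isCumulative.Build R _ R F Fnd (right_continuousW Fc).
pose G : cumulative R R := HB.pack F H.
by exists G.
Unshelve. all: by end_near. Qed.

End cumulative.

(** Restricting to ]0, 1] makes the measure finite, as the Radon-Nikodym theorem
requires of the dominated measure. *)
Definition ls01 (R : realType) (F : cumulative R R) :
    set (measurableTypeR R) -> \bar R :=
  mrestr (lebesgue_stieltjes_measure F) (measurable_itv `]0, 1]).

Section restricted_lebesgue_stieltjes.
Variable (R : realType) (F : cumulative R R).
HB.instance Definition _ := Measure.on (ls01 F).

Lemma lebesgue_stieltjes_itv (a b : R) : a <= b ->
  lebesgue_stieltjes_measure F `]a, b]%classic = (F b - F a)%:E.
Proof.
move=> ab; rewrite /lebesgue_stieltjes_measure /measure_extension.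
rewrite measurable_mu_extE/=; last exact: is_ocitv.
by rewrite wlength_itv_bnd// EFinB.
Qed.

Lemma ls01_fin : fin_num_fun (ls01 F).
Proof.
move=> A mA; rewrite ge0_fin_numE ?measure_ge0//.
apply: (@le_lt_trans _ _ (lebesgue_stieltjes_measure F `]0, 1]%classic)).
  by rewrite /ls01 /mrestr le_measure ?inE//; do ?[exact: measurableI|exact: subIsetr].
by rewrite lebesgue_stieltjes_itv ?ltry.
Qed.
HB.instance Definition _ := Measure_isFinite.Build _ _ _ (ls01 F) ls01_fin.

End restricted_lebesgue_stieltjes.

Section unit_slopes.
Variable R : realType.
Local Notation mu := (@lebesgue_measure R).

(** Both sides are measures which agree on the intervals ]a, b]. *)
Lemma lebesgue_stieltjes_add (F G : cumulative R R) : (forall x, F x + G x = x) ->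
  forall A, measurable A ->
    (lebesgue_stieltjes_measure F A + lebesgue_stieltjes_measure G A = mu A)%E.
Proof.
move=> FG A mA.
have mE B : measure_add (lebesgue_stieltjes_measure F)
    (lebesgue_stieltjes_measure G) B =
    (lebesgue_stieltjes_measure F B + lebesgue_stieltjes_measure G B)%E.
  exact: measure_addE.
rewrite -mE; apply/esym.
apply: lebesgue_measure_unique => // _ [[a b] _ <-].
rewrite [RHS]mE; have [ab|ba] := leP a b.
  rewrite !lebesgue_stieltjes_itv// -EFinD/=.
  rewrite [LHS](lebesgue_stieltjes_itv idfun ab)/=; congr EFin.
  by rewrite -[in LHS](FG a) -[in LHS](FG b); ring.
by rewrite set_itv_ge ?measure0 ?adde0// bnd_simp -leNgt ltW.
Qed.

(** Both F and id - F are nondecreasing, and their measures add up to Lebesgue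
measure. Hence both are absolutely continuous, with nonnegative densities whose
sum is 1 almost everywhere on ]0, 1]. *)
Lemma unit_slope_density (F : R -> R) : {homo F : x y / x <= y} ->
  (forall x y : R, x <= y -> F y - F x <= y - x) ->
  exists f : R -> R, [/\ measurable_fun setT f, forall x, 0 <= f x <= 1 &
    forall x y : R, 0 <= x -> x <= y -> y <= 1 ->
      \int[mu]_(t in `[x, y]) f t = F y - F x].
Proof.
move=> Fnd F1.
have [F' FF'] := contraction_cumulative Fnd F1.
(* id - F inherits both hypotheses on F *)
have [|x y xy|G' GG'] := @contraction_cumulative _ (fun x => x - F x).
- by move=> x y xy; have := F1 _ _ xy; lra.
- by have := Fnd _ _ xy; lra.
have FG A : measurable A -> (ls01 F' A + ls01 G' A = mu (A `&` `]0%R, 1%R]%classic))%E.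
  move=> mA; apply: lebesgue_stieltjes_add => //; last exact: measurableI.
  by move=> x; rewrite -FF' -GG' subrKC.
have Fmu : ls01 F' `<< mu.
  apply/null_content_dominatesP => A mA A0; apply/eqP.
  rewrite eq_le measure_ge0 andbT -A0.
  apply: (@le_trans _ _ (ls01 F' A + ls01 G' A)%E); first by rewrite leeDl.
  by rewrite FG// le_measure ?inE//; do ?[exact: measurableI|exact: subIsetl].
have Gmu : ls01 G' `<< mu.
  apply/null_content_dominatesP => A mA A0; apply/eqP.
  rewrite eq_le measure_ge0 andbT -A0.
  apply: (@le_trans _ _ (ls01 F' A + ls01 G' A)%E); first by rewrite leeDr.
  by rewrite FG// le_measure ?inE//; do ?[exact: measurableI|exact: subIsetl].
have [f [f0 ffin fi fE]] := radon_nikodym_sigma_finite Fmu.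
have [g [g0 gfin gi gE]] := radon_nikodym_sigma_finite Gmu.
have m01 : measurable (`]0%R, 1%R]%classic : set (measurableTypeR R)).
  exact: measurable_itv.
have fg1 : ae_eq mu `]0%R, 1%R]%classic (f \+ g)%E (cst 1%E).
  apply: integral_ae_eq => //.
    by apply: integrableD => //; apply: integrableS (_ : mu.-integrable setT _).
  move=> E E01 mE; rewrite integralD//; last 2 first.
    by apply: integrableS fi.
    by apply: integrableS gi.
  by rewrite -fE// -gE// FG// setIidl// integral_cst// mul1e.
(* on ]0, 1], f is at most 1 almost everywhere; truncate it to get this everywhere *)
exists (fun x => Num.min 1 (fine (f x))); split.
- apply: measurable_minr; first exact: measurable_cst.
  by apply: measurableT_comp => //; exact: measurable_int fi.
- move=> x; rewrite ge_min lexx le_min ler01/= andbT; apply: fine_ge0; exact: f0.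
- move=> x y x0 xy y1.
  have mf : measurable_fun setT (fun t => Num.min 1 (fine (f t))).
    apply: measurable_minr; first exact: measurable_cst.
    by apply: measurableT_comp => //; exact: measurable_int fi.
  rewrite -Rintegral_itv_obnd_cbnd; last first.
    apply: measurable_bounded_integrable.
    - exact: measurable_itv.
    - by rewrite [X in (X < _)%E](lebesgue_stieltjes_itv idfun xy) ltry.
    - exact: measurable_funTS.
    exists 1; split; rewrite ?num_real// => M M1 t _ /=.
    rewrite (le_trans _ (ltW M1))// ger0_norm ?ge_min ?lexx//.
    by rewrite le_min ler01; apply: fine_ge0; exact: f0.
  have : (ls01 F' `]x, y]%classic = (F y - F x)%:E).
    rewrite /ls01 /mrestr setIidl; first by rewrite lebesgue_stieltjes_itv// FF'.
    by apply: subset_itv; rewrite bnd_simp.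
  rewrite fE; last by [].
  rewrite /Rintegral => fxy; rewrite (_ : F y - F x = fine (F y - F x)%:E)// -fxy.
  congr fine; apply: ae_eq_integral.
  - exact: measurable_itv.
  - by apply/measurable_EFinP; exact: measurable_funTS.
  - by apply: measurable_funTS; exact: measurable_int fi.
  apply: filterS fg1 => t /= fg1 xyt.
  have {fg1} : (f t + g t = 1)%E.
    by apply: fg1; apply: subset_itv xyt; rewrite bnd_simp.
  rewrite -[f t]fineK// -[g t]fineK// -EFinD => -[fg1].
  by rewrite min_r// -fg1 lerDl; apply: fine_ge0; exact: g0.
Qed.
End unit_slopes.

Section bounded_slopes.
Variable R : realType.
Local Notation mu := (@lebesgue_measure R).
Implicit Types (b x z : R).

(** If b1 < b2, apply the case of slopes in [0, 1] to (beta - b1 id) / (b2 -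
b1), made constant outside [0, 1]. *)
Lemma bounded_slope_density b1 b2 (beta : R -> R) : b1 <= b2 ->
  (forall x z, 0 <= x -> x <= z -> z <= 1 ->
    b1 * (z - x) <= beta z - beta x <= b2 * (z - x)) ->
  exists B : R -> R, [/\ measurable_fun setT B, forall x, b1 <= B x <= b2 &
    forall x z, 0 <= x -> x <= z -> z <= 1 -> intg B x z = beta z - beta x].
Proof.
rewrite le_eqVlt => /predU1P[<-|b12] hb.
  exists (cst b1); split; [exact: measurable_cst|by move=> x; rewrite lexx|].
  move=> x z x0 xz z1; rewrite intg_cst//; apply/eqP.
  by rewrite eq_le; have := hb x z x0 xz z1.
have c0 : 0 < b2 - b1 by rewrite subr_gt0.
pose cl x : R := Num.max 0 (Num.min 1 x).
have clE x : 0 <= x -> x <= 1 -> cl x = x by move=> x0 x1; rewrite /cl min_r// max_r.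
have cl01 x : 0 <= cl x /\ cl x <= 1.
  rewrite /cl; case: (leP 1 x) => h1.
  - by case: (leP 0 1) => h0; split; lra.
  - by case: (leP 0 x) => h0; split; lra.
have clm x z : x <= z -> cl x <= cl z /\ cl z - cl x <= z - x.
  move=> xz; rewrite /cl.
  case: (leP 1 x) => h1; case: (leP 1 z) => h2.
  - by case: (leP 0 1) => h3; split; lra.
  - by case: (leP 0 1) => h3; case: (leP 0 z) => h4; split; lra.
  - by case: (leP 0 1) => h3; case: (leP 0 x) => h4; split; lra.
  - by case: (leP 0 x) => h3; case: (leP 0 z) => h4; split; lra.
pose F x := (beta (cl x) - b1 * cl x) / (b2 - b1).
have [||f [mf f01 fE]] := @unit_slope_density R F.
- move=> x z xz; have [xz' _] := clm x z xz.
  have [x0 _] := cl01 x; have [_ z1] := cl01 z.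
  have /andP[h _] := hb _ _ x0 xz' z1.
  by rewrite /F ler_pM2r ?invr_gt0//; lra.
- move=> x z xz; have [xz' xz''] := clm x z xz.
  have [x0 _] := cl01 x; have [_ z1] := cl01 z.
  have /andP[_ h] := hb _ _ x0 xz' z1.
  by rewrite /F -mulrBl ler_pdivrMr//; nra.
have bf : bmeas f.
  split; first exact: measurable_funTS.
  by exists 1 => x _ _; have /andP[f0 f1] := f01 x; rewrite ger0_norm.
exists (fun x => b1 + (b2 - b1) * f x); split.
- by apply: measurable_funD => //; apply: measurable_funM.
- by move=> x; have /andP[f0 f1] := f01 x; apply/andP; split; nra.
move=> x z x0 xz z1; rewrite intgD//; last 2 first.
- exact: bmeas_cst.
- by apply: bmeasM => //; exact: bmeas_cst.
rewrite intgZ// intg_cst// [intg f x z]fE// /F !clE//; last 2 first.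
- exact: le_trans z1.
- exact: le_trans x0 xz.
by field; rewrite gt_eqF.
Qed.

End bounded_slopes.

(** * Waves: the problem as a system of integral equations *)

(** Compared with [mode], the coefficient B is back and the equations are
integrated; compared with quasi-eigenvalues, weak derivatives are gone. *)
Record wave (R : realType) (b1 b2 a b : R) (B u v p q : R -> R) : Prop := Wave {
  wave_meas : measurable_fun setT B;
  wave_B : forall x, b1 <= B x <= b2;
  wave_u : forall x, 0 <= x -> x <= 1 -> u x = u 0 + intg p 0 x;
  wave_v : forall x, 0 <= x -> x <= 1 -> v x = v 0 + intg q 0 x;
  wave_p : forall x, 0 <= x -> x <= 1 ->
    p x = intg (fun t => - (((a ^+ 2 - b ^+ 2) * u t - 2 * a * b * v t) * B t)) 0 x;
  wave_q : forall x, 0 <= x -> x <= 1 ->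
    q x = intg (fun t => - (((a ^+ 2 - b ^+ 2) * v t + 2 * a * b * u t) * B t)) 0 x;
  wave_p1 : p 1 = b * u 1 + a * v 1;
  wave_q1 : q 1 = b * v 1 - a * u 1;
  wave_bu : bmeas u;
  wave_bv : bmeas v;
  wave_bp : bmeas p;
  wave_bq : bmeas q
}.

Section wave_theory.
Variable R : realType.
Implicit Types (C L a b x z : R) (B beta g P u v p q : R -> R).

Lemma bounded_bmeas b1 b2 B : measurable_fun setT B ->
  (forall x, b1 <= B x <= b2) -> bmeas B.
Proof.
move=> mB Bb; split; first exact: measurable_funTS.
exists (`|b1| + `|b2|) => x _ _; have /andP[h1 h2] := Bb x.
have := ler_norm b2; have := lerNnormlW (lexx `|b1|).
by have := normr_ge0 b1; have := normr_ge0 b2; rewrite ler_norml; lra.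
Qed.

(** The integral of g B over [s, t] differs from g(s) (beta t - beta s) by a
quadratic error, so P and the integral of - g B have the same increments up to
such an error. *)
Lemma quad_density_intg b1 b2 C L B beta g P : 0 <= b1 ->
  measurable_fun setT B -> (forall x, b1 <= B x <= b2) ->
  (forall x z, 0 <= x -> x <= z -> z <= 1 -> intg B x z = beta z - beta x) ->
  lip01 L g -> P 0 = 0 ->
  (forall x z, 0 <= x -> x <= z -> z <= 1 ->
    `|P z - P x + g x * (beta z - beta x)| <= C * (z - x) ^+ 2) ->
  forall x, 0 <= x -> x <= 1 -> P x = intg (fun t => - (g t * B t)) 0 x.
Proof.
move=> b10 mB Bb Bbeta gL P0 PC x x0 x1.
have bB := bounded_bmeas mB Bb.
have bg := bmeas_continuous (lip01_continuous gL).
have bgB : bmeas (fun t => - (g t * B t)) by apply: bmeasN; exact: bmeasM.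
have b20 : 0 <= b2 by have /andP[] := Bb 0; lra.
have := @quad_constant _ (fun x => P x - intg (fun t => - (g t * B t)) 0 x)
  (C + L * b2) _ x x0 x1.
rewrite P0 intg_point subrr => /(_ _)/eqP; rewrite subr_eq0 => h; apply/eqP; apply: h.
move=> s t s0 st t1.
rewrite -(intg_chasles bgB (lexx 0) s0 st t1).
have h1 : `|intg (fun r => - ((g r - g s) * B r)) s t| <= L * b2 * (t - s) ^+ 2.
  rewrite expr2 mulrA; apply: intg_le => //.
    by apply: bmeasN; apply: bmeasM => //; apply: bmeasB => //; exact: bmeas_cst.
  move=> r sr rt; rewrite normrN mulrAC.
  have /andP[B1 B2] := Bb r.
  apply: normM_le; last by rewrite ger0_norm//; lra.
  have r1 := le_trans rt t1.
  apply: le_trans (gL _ _ s0 sr r1) _.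
  by rewrite ler_wpM2l ?lerD2r// (lip01_ge0 gL).
have E : intg (fun r => - ((g r - g s) * B r)) s t =
    intg (fun r => - (g r * B r)) s t + g s * (beta t - beta s).
  rewrite -Bbeta// -intgZ// -intgD//; last by apply: bmeasM => //; exact: bmeas_cst.
  by apply: eq_intg => // r _ _; ring.
have := PC s t s0 st t1; rewrite E in h1.
by move: h1; rewrite !ler_norml; lra.
Qed.

Lemma mode_wave C b1 b2 a b beta u v p q : 0 <= b1 -> b1 <= b2 ->
  mode C b1 b2 a b beta u v p q -> exists B, wave b1 b2 a b B u v p q.
Proof.
move=> b10 b12 M.
have [B [mB Bb Bbeta]] := bounded_slope_density b12 (mode_beta M).
have lp : lip01 C p by move=> x z x0 xz z1; have [] := mode_lip M x0 xz z1.
have lq : lip01 C q by move=> x z x0 xz z1; have [] := mode_lip M x0 xz z1.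
have lu : lip01 C u by move=> x z x0 xz z1; have [] := mode_lip M x0 xz z1.
have lv : lip01 C v by move=> x z x0 xz z1; have [] := mode_lip M x0 xz z1.
exists B; split => //.
- by move=> x x0 x1; rewrite -(taylor_intg lp (mode_du M) (lexx 0) x0 x1) subrKC.
- by move=> x x0 x1; rewrite -(taylor_intg lq (mode_dv M) (lexx 0) x0 x1) subrKC.
- apply: (quad_density_intg (b1 := b1) (b2 := b2) (beta := beta)
    (C := C) (L := (`|a ^+ 2 - b ^+ 2| + `|2 * a * b|) * C)) => //; last exact: mode_dp M.
    move=> x z x0 xz z1.
    have := normM_le (lexx `|a ^+ 2 - b ^+ 2|) (lu x z x0 xz z1).
    have := normM_le (lexx `|2 * a * b|) (lv x z x0 xz z1).
    by rewrite !ler_norml; lra.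
  exact: mode_p0 M.
- apply: (quad_density_intg (b1 := b1) (b2 := b2) (beta := beta)
    (C := C) (L := (`|a ^+ 2 - b ^+ 2| + `|2 * a * b|) * C)) => //; last exact: mode_dq M.
    move=> x z x0 xz z1.
    have := normM_le (lexx `|a ^+ 2 - b ^+ 2|) (lv x z x0 xz z1).
    have := normM_le (lexx `|2 * a * b|) (lu x z x0 xz z1).
    by rewrite !ler_norml; lra.
  exact: mode_q0 M.
- exact: mode_p1 M.
- exact: mode_q1 M.
- exact: bmeas_continuous (lip01_continuous lu).
- exact: bmeas_continuous (lip01_continuous lv).
- exact: bmeas_continuous (lip01_continuous lp).
- exact: bmeas_continuous (lip01_continuous lq).
Qed.

End wave_theory.

(** * Waves and quasi-eigenvalues *)

Section quasi.
Variable R : realType.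
Implicit Types (C L a b x z k : R) (B beta g u v p q : R -> R).
Local Notation mu := (@lebesgue_measure R).

Lemma complex_ode (a b c u v r s : R) :
  Complex r s + (Complex a b) ^+ 2 * c%:C%C * Complex u v = 0 <->
  r = - (((a ^+ 2 - b ^+ 2) * u - 2 * a * b * v) * c) /\
  s = - (((a ^+ 2 - b ^+ 2) * v + 2 * a * b * u) * c).
Proof.
have -> : Complex r s + (Complex a b) ^+ 2 * c%:C%C * Complex u v =
    Complex (r + ((a ^+ 2 - b ^+ 2) * u - 2 * a * b * v) * c)
            (s + ((a ^+ 2 - b ^+ 2) * v + 2 * a * b * u) * c).
  by rewrite expr2; simpc; congr Complex; ring.
split=> [[h1 h2]|[-> ->]]; first by split; apply/eqP; rewrite -addr_eq0; apply/eqP.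
by rewrite !addNr.
Qed.

(** The boundary condition at 1 amounts to y'(1) = - i kappa y(1). *)
Lemma complex_bc (a b u v p q : R) : Complex a b != 0 ->
  Complex u v - 'i%C * Complex p q / Complex a b = 0 <->
  p = b * u + a * v /\ q = b * v - a * u.
Proof.
move=> k0.
have -> : Complex u v - 'i%C * Complex p q / Complex a b = 0 <->
    'i%C * Complex p q = Complex u v * Complex a b.
  split=> [/eqP|h]; last by rewrite h mulfK// subrr.
  by rewrite subr_eq0 => /eqP ->; rewrite divfK.
simpc; split=> [[h1 h2]|[-> ->]]; first by split; lra.
by congr Complex; ring.
Qed.

Lemma ae_imply (P Q : R -> Prop) : (forall x, P x -> Q x) ->
  {ae mu, forall x, P x} -> {ae mu, forall x, Q x}.
Proof. by move=> PQ; apply: (@filterS _ _ (ae_filter_ringOfSetsType mu)). Qed.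

Lemma ae_imply2 (P Q S : R -> Prop) : (forall x, P x -> Q x -> S x) ->
  {ae mu, forall x, P x} -> {ae mu, forall x, Q x} -> {ae mu, forall x, S x}.
Proof. by move=> PQ; apply: (@filterS2 _ _ (ae_filter_ringOfSetsType mu)). Qed.

Lemma bmeas_Linfty g : bmeas g -> Linfty g.
Proof.
move=> [mg [M gM]]; split.
  apply: measurable_funS mg; first exact: measurable_itv.
  by apply: subset_itv; rewrite bnd_simp.
exists M; apply: aeW => x; rewrite in_itv/= => /andP[x0 x1].
by apply: gM; exact: ltW.
Qed.

Lemma intg_continuous u p : bmeas p ->
  (forall x, 0 <= x -> x <= 1 -> u x = u 0 + intg p 0 x) ->
  {within `[0, 1], continuous u}.
Proof.
move=> bp up; have [_ [M pM]] := bp; apply: (@lip01_continuous _ M) => x z x0 xz z1.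
rewrite (up z (le_trans x0 xz) z1) (up x x0 (le_trans xz z1)).
have := intg_lip bp pM x0 xz z1; congr (`|_| <= _); ring.
Qed.

Lemma intg_W1infty u p : bmeas p ->
  (forall x, 0 <= x -> x <= 1 -> u x = u 0 + intg p 0 x) -> W1infty u p.
Proof.
move=> bp up; have cu := intg_continuous bp up.
split => //; [exact/bmeas_Linfty/bmeas_continuous|exact: bmeas_Linfty|].
exact: intg_weak_deriv.
Qed.

Lemma wave_quasi_eigenvalue (b1 b2 : R) a b B u v p q :
  wave b1 b2 a b B u v p q -> Complex a b != 0 ->
  (exists x, [/\ 0 <= x, x <= 1 & u x ^+ 2 + v x ^+ 2 != 0]) ->
  Ad b1 b2 B /\ quasi_eigenvalues B (Complex a b).
Proof.
move=> W k0 [x [x0 x1 yx]].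
have bB := bounded_bmeas (wave_meas W) (wave_B W).
have bu := wave_bu W; have bv := wave_bv W.
split.
  by split; [exact: bmeas_Linfty|apply: aeW => t _; exact: wave_B W t].
split => //.
pose p1 t := - (((a ^+ 2 - b ^+ 2) * u t - 2 * a * b * v t) * B t).
pose q1 t := - (((a ^+ 2 - b ^+ 2) * v t + 2 * a * b * u t) * B t).
have bp1 : bmeas p1.
  apply: bmeasN; apply: bmeasM => //; apply: bmeasB;
  by apply: bmeasM => //; exact: bmeas_cst.
have bq1 : bmeas q1.
  apply: bmeasN; apply: bmeasM => //; apply: bmeasD;
  by apply: bmeasM => //; exact: bmeas_cst.
have p0 : p 0 = 0 by rewrite (wave_p W)// intg_point.
have q0 : q 0 = 0 by rewrite (wave_q W)// intg_point.
exists (fun t => Complex (u t) (v t)), (fun t => Complex (p t) (q t)),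
  (fun t => Complex (p1 t) (q1 t)); split.
- split; split.
  + by apply: intg_W1infty; [exact: wave_bp W|exact: wave_u W].
  + apply: intg_W1infty => //= t t0 t1.
    by rewrite p0 add0r; exact: wave_p W t t0 t1.
  + by apply: intg_W1infty; [exact: wave_bq W|exact: wave_v W].
  + apply: intg_W1infty => //= t t0 t1.
    by rewrite q0 add0r; exact: wave_q W t t0 t1.
- exists x; first by rewrite in_itv/= x0.
  apply: contra yx; rewrite eq_complex/= => /andP[/eqP -> /eqP ->].
  by rewrite expr0n/= addr0.
- by apply: aeW => t _; apply/complex_ode.
- by rewrite p0 q0.
- by apply/complex_bc => //; split; [exact: wave_p1 W|exact: wave_q1 W].
Qed.

(** Used to replace a given second derivative by the bounded function that the
differential equation makes it equal to almost everywhere. *)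
Lemma weak_deriv_ae f (g g' : R -> R) : Linfty g -> bmeas g' ->
  {ae mu, forall x, x \in `]0, 1[ -> g x = g' x} ->
  weak_deriv f g -> weak_deriv f g'.
Proof.
move=> [mg _] bg' gg' fg phi tphi; rewrite fg//; congr (- _).
have [_ cphi _] := tphi; have [M _ phil] := test_fun_lip tphi.
have [mphi _] := bmeas_continuous (lip01_continuous phil).
have sub01 : `]0, 1[%classic `<=` (`[0, 1]%classic : set R).
  by apply: subset_itv; rewrite bnd_simp.
have mphi' : measurable_fun (`]0, 1[%classic : set R) phi.
  by apply: measurable_funS mphi => //; exact: measurable_itv.
congr fine; apply: ae_eq_integral.
- exact: measurable_itv.
- by apply/measurable_EFinP; apply: measurable_funM.
- apply/measurable_EFinP; apply: measurable_funM => //.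
  by apply: measurable_funS bg'.1 => //; exact: measurable_itv.
- by apply: ae_imply gg' => x gg' x01 /=; rewrite gg'.
Qed.

(** The coefficient is truncated to take values in [b1, b2] everywhere, which
changes it on a null set. *)
Lemma quasi_eigenvalue_wave (b1 b2 : R) a b B0 : b1 <= b2 ->
  Ad b1 b2 B0 -> quasi_eigenvalues B0 (Complex a b) ->
  exists B u v p q, wave b1 b2 a b B u v p q /\
    exists x, [/\ 0 <= x, x <= 1 & u x ^+ 2 + v x ^+ 2 != 0].
Proof.
move=> b12 [[mB0 _] Bb] [k0 [y [y1 [y2 [[[Wu Wp] [Wv Wq]] [x x01 yx] ode bc0 bc1]]]]].
pose B t := Num.max b1 (Num.min b2 ((B0 \_ `]0, 1[) t)).
have mB : measurable_fun setT B.
  apply: measurable_maxr; first exact: measurable_cst.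
  apply: measurable_minr; first exact: measurable_cst.
  by apply/(measurable_restrictT _ _).1 => //; exact: measurable_itv.
have BB t : b1 <= B t <= b2.
  by rewrite /B le_max lexx/= ge_max b12 ge_min lexx.
have BB0 : {ae mu, forall t, t \in `]0, 1[ -> B0 t = B t}.
  apply: ae_imply Bb => t Bt t01; have /andP[h1 h2] := Bt t01.
  by rewrite /B patchE mem_set// min_r// max_r.
have bB := bounded_bmeas mB BB.
set u := fun t => complex.Re (y t) in Wu Wp.
set v := fun t => complex.Im (y t) in Wv Wq.
set p := fun t => complex.Re (y1 t) in Wu Wp.
set q := fun t => complex.Im (y1 t) in Wv Wq.
have [cu _ _ uw] := Wu; have [cp _ Lp pw] := Wp.
have [cv _ _ vw] := Wv; have [cq _ Lq qw] := Wq.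
have bu := bmeas_continuous cu; have bv := bmeas_continuous cv.
have bp := bmeas_continuous cp; have bq := bmeas_continuous cq.
have yE t : y t = Complex (u t) (v t) by rewrite /u /v; case: (y t).
have y1E t : y1 t = Complex (p t) (q t) by rewrite /p /q; case: (y1 t).
pose p1 t := - (((a ^+ 2 - b ^+ 2) * u t - 2 * a * b * v t) * B t).
pose q1 t := - (((a ^+ 2 - b ^+ 2) * v t + 2 * a * b * u t) * B t).
have bp1 : bmeas p1.
  apply: bmeasN; apply: bmeasM => //; apply: bmeasB;
  by apply: bmeasM => //; exact: bmeas_cst.
have bq1 : bmeas q1.
  apply: bmeasN; apply: bmeasM => //; apply: bmeasD;
  by apply: bmeasM => //; exact: bmeas_cst.
have odeE : {ae mu, forall t, t \in `]0, 1[ ->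
    complex.Re (y2 t) = p1 t /\ complex.Im (y2 t) = q1 t}.
  apply: ae_imply2 ode BB0 => t odet Bt t01.
  have := odet t01; rewrite (Bt t01) yE.
  by case: (y2 t) => r s /complex_ode.
have p0 : p 0 = 0 by rewrite /p bc0.
have q0 : q 0 = 0 by rewrite /q bc0.
move: bc1; rewrite yE y1E => /(complex_bc _ _ _ _ k0)[bcp bcq].
exists B, u, v, p, q; split.
  split => //.
  - exact: weak_deriv_intg.
  - exact: weak_deriv_intg.
  - move=> t t0 t1; rewrite -[LHS](subr0) -[X in _ - X]p0.
    rewrite (@weak_deriv_intg _ p p1 _ _ _ t)//; first by rewrite addrC addKr.
    apply: weak_deriv_ae pw => //.
    by apply: ae_imply odeE => s h s01; case: (h s01).
  - move=> t t0 t1; rewrite -[LHS](subr0) -[X in _ - X]q0.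
    rewrite (@weak_deriv_intg _ q q1 _ _ _ t)//; first by rewrite addrC addKr.
    apply: weak_deriv_ae qw => //.
    by apply: ae_imply odeE => s h s01; case: (h s01).
move: x01; rewrite in_itv/= => /andP[x0 x1].
exists x; split => //; apply: contra yx => /eqP uv.
have := sqr_ge0 (u x); have := sqr_ge0 (v x) => h1 h2.
by rewrite yE eq_complex/= -!(sqrf_eq0 (_ x)) !eq_le h1 h2 !andbT; apply/andP; split; lra.
Qed.

Lemma wave_scale (b1 b2 : R) a b k B u v p q : wave b1 b2 a b B u v p q ->
  wave b1 b2 a b B (fun t => k * u t) (fun t => k * v t)
    (fun t => k * p t) (fun t => k * q t).
Proof.
move=> W.
have bB := bounded_bmeas (wave_meas W) (wave_B W).
have bu := wave_bu W; have bv := wave_bv W.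
have bp := wave_bp W; have bq := wave_bq W.
have bk := bmeas_cst k.
split; do ?by [exact: wave_meas W|exact: wave_B W|apply: bmeasM].
- by move=> x x0 x1; rewrite (wave_u W x0 x1) intgZ// mulrDr.
- by move=> x x0 x1; rewrite (wave_v W x0 x1) intgZ// mulrDr.
- move=> x x0 x1; rewrite (wave_p W x0 x1) -intgZ//.
    by apply: eq_intg => // t _ _; ring.
  apply: bmeasN; apply: bmeasM => //; apply: bmeasB;
  by apply: bmeasM => //; exact: bmeas_cst.
- move=> x x0 x1; rewrite (wave_q W x0 x1) -intgZ//.
    by apply: eq_intg => // t _ _; ring.
  apply: bmeasN; apply: bmeasM => //; apply: bmeasD;
  by apply: bmeasM => //; exact: bmeas_cst.
- by rewrite (wave_p1 W); ring.
- by rewrite (wave_q1 W); ring.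
Qed.

Lemma wave_normalize (b1 b2 : R) a b B u v p q : wave b1 b2 a b B u v p q ->
  (exists x, [/\ 0 <= x, x <= 1 & u x ^+ 2 + v x ^+ 2 != 0]) ->
  exists u' v' p' q', [/\ wave b1 b2 a b B u' v' p' q',
    forall x, 0 <= x -> x <= 1 -> u' x ^+ 2 + v' x ^+ 2 <= 1 &
    exists x, [/\ 0 <= x, x <= 1 & u' x ^+ 2 + v' x ^+ 2 = 1]].
Proof.
move=> W [x [x0 x1 yx]].
have cu := intg_continuous (wave_bp W) (wave_u W).
have cv := intg_continuous (wave_bq W) (wave_v W).
have cuv : {within `[0, 1], continuous (fun t => u t ^+ 2 + v t ^+ 2)}.
  by move=> t; apply: cvgD; apply: cvgM; [exact: cu|exact: cu|exact: cv|exact: cv].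
have [s s01 sM] := EVT_max ler01 cuv.
move: (s01); rewrite in_itv/= => /andP[s0 s1].
set m := u s ^+ 2 + v s ^+ 2 in sM.
have m0 : 0 < m.
  apply: lt_le_trans (sM x _); last by rewrite in_itv/= x0.
  by rewrite lt_neqAle eq_sym yx addr_ge0// sqr_ge0.
pose k := (Num.sqrt m)^-1.
have k2 : k ^+ 2 = m^-1 by rewrite exprVn sqr_sqrtr// ltW.
exists (fun t => k * u t), (fun t => k * v t), (fun t => k * p t), (fun t => k * q t).
split; first exact: wave_scale.
  move=> t t0 t1; rewrite !exprMn -mulrDr k2 ler_pdivrMl// mulr1; apply: sM.
  by rewrite in_itv/= t0.
exists s; split => //.
by rewrite !exprMn -mulrDr k2 -/m mulVf// gt_eqF.
Qed.

End quasi.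

(** * From waves back to modes *)

Section wave_mode.
Variable R : realType.
Implicit Types (A C L a b x z k : R) (B beta g P u v p q : R -> R).

Section prim.
Variables (b1 b2 L M : R) (B g P : R -> R).
Hypotheses (b10 : 0 <= b1) (mB : measurable_fun setT B).
Hypothesis BB : forall x, b1 <= B x <= b2.
Hypotheses (bg : bmeas g) (gM : forall x, 0 <= x -> x <= 1 -> `|g x| <= M).
Hypothesis PE : forall x, 0 <= x -> x <= 1 -> P x = intg (fun t => - (g t * B t)) 0 x.

Let bB : bmeas B. Proof. exact: bounded_bmeas mB BB. Qed.

Let bgB : bmeas (fun t => - (g t * B t)).
Proof. by apply: bmeasN; exact: bmeasM. Qed.

Let PB x z : 0 <= x -> x <= z -> z <= 1 ->
  P z - P x = intg (fun t => - (g t * B t)) x z.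
Proof.
move=> x0 xz z1; rewrite (PE (le_trans x0 xz) z1) (PE x0 (le_trans xz z1)).
by rewrite -(intg_chasles bgB (lexx 0) x0 xz z1) addrC addKr.
Qed.

Let B_norm x : `|B x| <= b2.
Proof. by have /andP[h1 h2] := BB x; rewrite ger0_norm// (le_trans b10). Qed.

Lemma prim_lip : lip01 (M * b2) P.
Proof.
move=> x z x0 xz z1; rewrite PB//; apply: intg_le => // t xt tz.
rewrite normrN; apply: normM_le (B_norm t); apply: gM.
- exact: le_trans xt.
- exact: le_trans z1.
Qed.

Lemma prim_le x : 0 <= x -> x <= 1 -> `|P x| <= M * b2.
Proof.
move=> x0 x1; have := prim_lip (lexx 0) x0 x1.
rewrite [P 0]PE// intg_point !subr0 => h; apply: le_trans h _.
rewrite ler_piMr// mulr_ge0//; first exact: le_trans (gM x0 x1).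
exact: le_trans (B_norm 0).
Qed.

Lemma prim_quad : lip01 L g -> forall x z, 0 <= x -> x <= z -> z <= 1 ->
  `|P z - P x + g x * (intg B 0 z - intg B 0 x)| <= L * b2 * (z - x) ^+ 2.
Proof.
move=> gL x z x0 xz z1; rewrite PB//.
rewrite -(intg_chasles bB (lexx 0) x0 xz z1) [_ + intg B x z]addrC addrK -intgZ//.
rewrite -intgD//; last by apply: bmeasM => //; exact: bmeas_cst.
rewrite expr2 mulrA; apply: intg_le => //.
  by apply: bmeasD => //; apply: bmeasM => //; exact: bmeas_cst.
move=> t xt tz.
have -> : - (g t * B t) + g x * B t = - ((g t - g x) * B t) by ring.
rewrite normrN mulrAC; apply: normM_le (B_norm t).
apply: le_trans (gL _ _ x0 xt (le_trans tz z1)) _.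
by rewrite ler_wpM2l ?lerD2r// (lip01_ge0 gL).
Qed.

End prim.

Lemma lip01_le C L g : C <= L -> lip01 C g -> lip01 L g.
Proof.
move=> CL gC x z x0 xz z1; apply: le_trans (gC x z x0 xz z1) _.
by rewrite ler_wpM2r// subr_ge0.
Qed.

(** The number M = 4 A^2 b2 bounds the components of y'' = - kappa^2 B y, hence
the Lipschitz constants of u, v, p and q and the error in the Taylor estimates
of u and v; M^2 bounds the error in those of p and q, and 8 b2^2 is the constant
in |y(1)|^2 <= C |kappa|^2, which follows from |y'(1)| = |kappa| |y(1)| and from
the size of y''. *)
Lemma wave_mode (b1 b2 : R) A a b B u v p q : 0 <= b1 -> b1 <= b2 ->
  `|a| <= A -> `|b| <= A -> Complex a b != 0 ->
  wave b1 b2 a b B u v p q ->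
  (forall x, 0 <= x -> x <= 1 -> u x ^+ 2 + v x ^+ 2 <= 1) ->
  (exists x, [/\ 0 <= x, x <= 1 & u x ^+ 2 + v x ^+ 2 = 1]) ->
  mode (4 * A ^+ 2 * b2 + (4 * A ^+ 2 * b2) ^+ 2 + 8 * b2 ^+ 2) b1 b2 a b
    (intg B 0) u v p q.
Proof.
move=> b10 b12 aA bA k0 W le1 sup1.
have mB := wave_meas W; have BB := wave_B W.
have bu := wave_bu W; have bv := wave_bv W.
have bp := wave_bp W; have bq := wave_bq W.
have bB := bounded_bmeas mB BB.
have b20 : 0 <= b2 by exact: le_trans b12.
pose s := a ^+ 2 + b ^+ 2.
have s0 : 0 < s.
  rewrite lt_neqAle addr_ge0 ?sqr_ge0// andbT eq_sym; apply: contra k0 => /eqP s0.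
  have := sqr_ge0 a; have := sqr_ge0 b => h1 h2.
  rewrite /s in s0; rewrite eq_complex/= -(sqrf_eq0 a) -(sqrf_eq0 b).
  by rewrite !eq_le h1 h2 !andbT; apply/andP; split; lra.
have sA : s <= 2 * A ^+ 2.
  have : a ^+ 2 <= A ^+ 2 by move: aA; rewrite ler_norml; nra.
  have : b ^+ 2 <= A ^+ 2 by move: bA; rewrite ler_norml; nra.
  by rewrite /s; lra.
set c := a ^+ 2 - b ^+ 2; set d := 2 * a * b.
have cs : `|c| <= s.
  by rewrite ler_norml /c /s; have := sqr_ge0 a; have := sqr_ge0 b; lra.
have ds : `|d| <= s.
  by rewrite ler_norml /d /s; have := sqr_ge0 (a - b); have := sqr_ge0 (a + b); lra.
have uv1 x : 0 <= x -> x <= 1 -> `|u x| <= 1 /\ `|v x| <= 1.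
  move=> x0 x1; have h := le1 x x0 x1.
  by split; rewrite ler_norml; apply/andP; split; nra.
pose g t := c * u t - d * v t; pose h t := c * v t + d * u t.
have bg : bmeas g.
  by apply: bmeasB; apply: bmeasM => //; exact: bmeas_cst.
have bh : bmeas h.
  by apply: bmeasD; apply: bmeasM => //; exact: bmeas_cst.
have gs x : 0 <= x -> x <= 1 -> `|g x| <= 2 * s.
  move=> x0 x1; have [u1 v1] := uv1 x x0 x1.
  by have := normM_le cs u1; have := normM_le ds v1; rewrite /g !ler_norml; lra.
have hs x : 0 <= x -> x <= 1 -> `|h x| <= 2 * s.
  move=> x0 x1; have [u1 v1] := uv1 x x0 x1.
  by have := normM_le cs v1; have := normM_le ds u1; rewrite /h !ler_norml; lra.
have pE := wave_p W; have qE := wave_q W.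
set K := 4 * A ^+ 2 * b2; set C := K + _ + _.
have A0 : 0 <= A by exact: le_trans aA.
have K0 : 0 <= K by rewrite /K; apply: mulr_ge0 => //; have := sqr_ge0 A; lra.
have sK : 2 * s * b2 <= K by rewrite /K ler_wpM2r//; lra.
have KC : K <= C by rewrite /C; have := sqr_ge0 K; have := sqr_ge0 b2; lra.
have K2C : K ^+ 2 <= C by rewrite /C; have := sqr_ge0 b2; lra.
have bC : 8 * b2 ^+ 2 <= C by rewrite /C; have := sqr_ge0 K; lra.
have pK x : 0 <= x -> x <= 1 -> `|p x| <= 2 * s * b2.
  exact: (prim_le b10 mB BB bg gs pE).
have qK x : 0 <= x -> x <= 1 -> `|q x| <= 2 * s * b2.
  exact: (prim_le b10 mB BB bh hs qE).
have pl : lip01 K p by apply: lip01_le sK _; exact: (prim_lip b10 mB BB bg gs pE).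
have ql : lip01 K q by apply: lip01_le sK _; exact: (prim_lip b10 mB BB bh hs qE).
have dE F f x z : bmeas f -> (forall x, 0 <= x -> x <= 1 -> F x = F 0 + intg f 0 x) ->
    0 <= x -> x <= z -> z <= 1 -> F z - F x = intg f x z.
  move=> bf FE x0 xz z1; rewrite (FE z (le_trans x0 xz) z1) (FE x x0 (le_trans xz z1)).
  by rewrite -(intg_chasles bf (lexx 0) x0 xz z1); ring.
have ul : lip01 K u.
  move=> x z x0 xz z1; rewrite (dE _ p)//; last exact: wave_u W.
  apply: intg_le => // t xt tz; apply: le_trans sK; apply: pK.
  - exact: le_trans xt.
  - exact: le_trans z1.
have vl : lip01 K v.
  move=> x z x0 xz z1; rewrite (dE _ q)//; last exact: wave_v W.
  apply: intg_le => // t xt tz; apply: le_trans sK; apply: qK.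
  - exact: le_trans xt.
  - exact: le_trans z1.
have gl : lip01 (2 * s * K) g.
  move=> x z x0 xz z1.
  have := normM_le cs (ul x z x0 xz z1); have := normM_le ds (vl x z x0 xz z1).
  by rewrite /g !ler_norml; lra.
have hl : lip01 (2 * s * K) h.
  move=> x z x0 xz z1.
  have := normM_le cs (vl x z x0 xz z1); have := normM_le ds (ul x z x0 xz z1).
  by rewrite /h !ler_norml; lra.
have sKC : 2 * s * K * b2 <= C.
  apply: le_trans K2C; rewrite mulrAC expr2; exact: ler_wpM2r.
split.
- by rewrite intg_point.
- move=> x z x0 xz z1.
  have -> : intg B 0 z - intg B 0 x = intg B x z.
    by rewrite -(intg_chasles bB (lexx 0) x0 xz z1); ring.
  have [Bx1 Bx2] : b1 * (z - x) <= intg B x z /\ intg B x z <= b2 * (z - x).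
    (* both bounds at once: B is within (b2 - b1) / 2 of the midpoint *)
    pose m := (b1 + b2) / 2.
    have : `|intg (fun t => B t - m) x z| <= (b2 - b1) / 2 * (z - x).
      apply: intg_le => //; first by apply: bmeasB => //; exact: bmeas_cst.
      by move=> t _ _; have /andP[h1 h2] := BB t; rewrite ler_norml /m; lra.
    rewrite intgB//; last exact: bmeas_cst.
    by rewrite intg_cst// ler_norml /m; split; lra.
  by rewrite Bx1.
- exact: sup1.
- exact: le1.
- by rewrite pE// intg_point.
- by rewrite qE// intg_point.
- exact: wave_p1 W.
- exact: wave_q1 W.
- have p1 := pK 1 ler01 (lexx 1); have q1 := qK 1 ler01 (lexx 1).
  have pp : p 1 ^+ 2 <= (2 * s * b2) ^+ 2 by move: p1; rewrite ler_norml; nra.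
  have qq : q 1 ^+ 2 <= (2 * s * b2) ^+ 2 by move: q1; rewrite ler_norml; nra.
  have E : p 1 ^+ 2 + q 1 ^+ 2 = s * (u 1 ^+ 2 + v 1 ^+ 2).
    by rewrite (wave_p1 W) (wave_q1 W) /s; ring.
  have : s * (u 1 ^+ 2 + v 1 ^+ 2) <= s * (8 * b2 ^+ 2 * s).
    by rewrite -E; move: pp qq; lra.
  rewrite ler_pM2l// => H; apply: le_trans H _.
  by rewrite ler_wpM2r// ltW.
- by move=> x x0 x1; apply: le_trans (pK x x0 x1) _; exact: le_trans KC.
- by move=> x x0 x1; apply: le_trans (qK x x0 x1) _; exact: le_trans KC.
- by move=> x z x0 xz z1; split; apply: (@lip01_le K C) => //.
- move=> x z x0 xz z1; rewrite (dE _ p)//; last exact: wave_u W.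
  apply: le_trans (intg_taylor x0 xz z1 bp pl) _.
  by rewrite ler_wpM2r// sqr_ge0.
- move=> x z x0 xz z1; rewrite (dE _ q)//; last exact: wave_v W.
  apply: le_trans (intg_taylor x0 xz z1 bq ql) _.
  by rewrite ler_wpM2r// sqr_ge0.
- move=> x z x0 xz z1; apply: le_trans (prim_quad b10 mB BB bg pE gl x0 xz z1) _.
  by rewrite ler_wpM2r// sqr_ge0.
- move=> x z x0 xz z1; apply: le_trans (prim_quad b10 mB BB bh qE hl x0 xz z1) _.
  by rewrite ler_wpM2r// sqr_ge0.
Qed.

Lemma quasi_eigenvalue_mode (b1 b2 : R) A B (kappa : R[i]) : 0 <= b1 -> b1 <= b2 ->
  Ad b1 b2 B -> quasi_eigenvalues B kappa ->
  `|complex.Re kappa| <= A -> `|complex.Im kappa| <= A ->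
  exists beta u v p q,
    mode (4 * A ^+ 2 * b2 + (4 * A ^+ 2 * b2) ^+ 2 + 8 * b2 ^+ 2) b1 b2
      (complex.Re kappa) (complex.Im kappa) beta u v p q.
Proof.
case: kappa => a b b10 b12 adB Bk /= aA bA; have [k0 _] := Bk.
have [B' [u [v [p [q [W y0]]]]]] := quasi_eigenvalue_wave b12 adB Bk.
have [u' [v' [p' [q' [W' le1 sup1]]]]] := wave_normalize W y0.
by exists (intg B' 0), u', v', p', q'; exact: wave_mode W' le1 sup1.
Qed.

Lemma mode_quasi_eigenvalue (b1 b2 : R) C a b beta u v p q : 0 <= b1 -> b1 <= b2 ->
  mode C b1 b2 a b beta u v p q ->
  exists B, Ad b1 b2 B /\ quasi_eigenvalues B (Complex a b).
Proof.
move=> b10 b12 M; have [B W] := mode_wave b10 b12 M; exists B.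
apply: (wave_quasi_eigenvalue W).
  by rewrite eq_complex/= [b == 0]gt_eqF ?andbF//; exact: mode_Im_gt0 b10 b12 M.
have [x [x0 x1 yx]] := mode_sup M.
by exists x; split => //; rewrite yx oner_eq0.
Qed.

End wave_mode.

(** * The minimum is attained and positive *)

Theorem corollary2p2 (R : realType) (b1 b2 alpha1 alpha2 : R)
    (b1_ge0 : 0 <= b1) (b1_le_b2 : b1 <= b2) (b2_gt0 : 0 < b2)
    (alpha1_le_alpha2 : alpha1 <= alpha2)
    (Ad_nonempty : Ad_strip b1 b2 alpha1 alpha2 !=set0) :
  exists Bmin : R -> R,
    [/\ Ad_strip b1 b2 alpha1 alpha2 Bmin,
        forall B : R -> R, Ad_strip b1 b2 alpha1 alpha2 B ->
          (J_strip alpha1 alpha2 Bmin <= J_strip alpha1 alpha2 B)%E &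
        (0 < J_strip alpha1 alpha2 Bmin)%E].
Proof.
pose S : set R := [set complex.Im kappa | kappa in
  [set kappa : R[i] | alpha1 <= complex.Re kappa <= alpha2 /\
    exists2 B, Ad b1 b2 B & quasi_eigenvalues B kappa]].
have S_gt0 m : S m -> 0 < m.
  move=> [k [_ [B adB Bk]] <-].
  have ReA : `|complex.Re k| <= `|complex.Re k| + `|complex.Im k| by rewrite lerDl.
  have ImA : `|complex.Im k| <= `|complex.Re k| + `|complex.Im k| by rewrite lerDr.
  have [beta [u [v [p [q M]]]]] :=
    quasi_eigenvalue_mode b1_ge0 b1_le_b2 adB Bk ReA ImA.
  exact: mode_Im_gt0 b1_ge0 b1_le_b2 M.
have S0 : S !=set0.
  case: Ad_nonempty => B [adB [k Bk ka]].
  by exists (complex.Im k), k => //; split => //; exists B.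
have infS : has_inf S.
  by split => //; exists 0 => m /S_gt0/ltW.
pose m := inf S.
have mS x : S x -> m <= x by move=> Sx; apply: ge_inf => //; case: infS.
have m0 : 0 <= m by apply: lb_le_inf => // x /S_gt0/ltW.
have /choice[k_ kP] (n : nat) : exists k : R[i],
    [/\ alpha1 <= complex.Re k <= alpha2,
        exists2 B, Ad b1 b2 B & quasi_eigenvalues B k,
        m <= complex.Im k & complex.Im k < m + n.+1%:R^-1].
  have n0 : 0 < n.+1%:R^-1 :> R by rewrite invr_gt0.
  have [_ [k [ka kB] <-] kn] := inf_adherent n0 infS.
  by exists k; split => //; apply: mS; exists k.
(* a bound for the real and imaginary parts along the minimizing sequence *)
pose A := `|alpha1| + `|alpha2| + m + 1.
have ReA n : `|complex.Re (k_ n)| <= A.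
  have [/andP[h1 h2] _ _ _] := kP n.
  have := ler_norm alpha2; have := lerNnormlW (lexx `|alpha1|).
  by have := normr_ge0 alpha1; have := normr_ge0 alpha2; rewrite ler_norml /A; lra.
have ImA n : `|complex.Im (k_ n)| <= A.
  have [_ _ h1 h2] := kP n.
  have h3 : complex.Im (k_ n) < m + 1.
    by apply: lt_le_trans h2 _; rewrite lerD2l invf_le1// ler1n.
  rewrite ger0_norm; last exact: le_trans h1.
  by apply: le_trans (ltW h3) _; rewrite lerD2r lerDr addr_ge0.
pose C := 4 * A ^+ 2 * b2 + (4 * A ^+ 2 * b2) ^+ 2 + 8 * b2 ^+ 2.
have /choice[f_ M_] (n : nat) :
    exists f : (R -> R) * (R -> R) * (R -> R) * (R -> R) * (R -> R),
    mode C b1 b2 (complex.Re (k_ n)) (complex.Im (k_ n))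
      f.1.1.1.1 f.1.1.1.2 f.1.1.2 f.1.2 f.2.
  have [_ [B adB Bk] _ _] := kP n.
  have [beta [u [v [p [q M]]]]] :=
    quasi_eigenvalue_mode b1_ge0 b1_le_b2 adB Bk (ReA n) (ImA n).
  by exists (beta, u, v, p, q).
have [U [UU ooU]] := ultraFilterLemma eventually_filter.
have [a [b [beta [u [v [p [q [al bl M]]]]]]]] := mode_limit UU b1_ge0 b1_le_b2 ReA ImA M_.
have a1 : alpha1 <= a.
  by apply: (ulim_le UU (@ulim_cst R U UU alpha1) al) => n; have [/andP[]] := kP n.
have a2 : a <= alpha2.
  by apply: (ulim_le UU al (@ulim_cst R U UU alpha2)) => n; have [/andP[]] := kP n.
have bm : b = m.
  apply/eqP; rewrite eq_le; apply/andP; split; last first.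
    by apply: (ulim_le UU (@ulim_cst R U UU m) bl) => n; have [] := kP n.
  apply: (ulim_le UU bl (g := fun n => m + n.+1%:R^-1)); last first.
    by move=> n; have [_ _ _ /ltW] := kP n.
  rewrite -[m in ulim _ _ m]addr0; apply: (ulimD UU); first exact: ulim_cst.
  by apply: cvg_trans (@cvg_harmonic R); apply: cvg_app.
have [B [adB Bk]] := mode_quasi_eigenvalue b1_ge0 b1_le_b2 M.
have JB : J_strip alpha1 alpha2 B = m%:E.
  apply/eqP; rewrite eq_le; apply/andP; split.
    apply: ereal_inf_lbound; exists (Complex a b) => /=; last by rewrite bm.
    by split => //; rewrite a1 a2.
  apply: le_ereal_inf_tmp => _ [k [ka kB] <-]; rewrite lee_fin; apply: mS.
  by exists k => //; split => //; exists B.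
exists B; split.
- by split => //; exists (Complex a b) => //=; rewrite a1.
- move=> B' [adB' _]; rewrite JB; apply: le_ereal_inf_tmp => _ [k [ka kB] <-].
  by rewrite lee_fin; apply: mS; exists k => //; split => //; exists B'.
- rewrite JB lte_fin -bm; exact: mode_Im_gt0 b1_ge0 b1_le_b2 M.
Qed.
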